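(* Let $T$ be a complete monadically NIP theory with monster model $\mathfrak{C}$, and let $M\preceq\mathfrak{C}$ be small. Let $p(x_1,\dots,x_n)\in S_n(\mathfrak{C})$ be any $M$-invariant global type, and for each $i$ let $p_i=p{\restriction}_{x_i}$. Partition $[n]=F\sqcup G\sqcup D$ (some of these might be empty), where - $F=\{i\in[n]: p_i$ is finitely satisfied in $M$, but is not $M$-definable$\}$; - $G=\{i\in[n]: p_i$ is generically stable over $M\}$; - $D=\{i\in[n]: p_i$ is $M$-definable but not finitely satisfied in $M\}$. Let $p_F(\bar x_F)$, $p_G(\bar x_G)$, $p_D(\bar x_D)$ be the restrictions of $p$ to the three subsequences $\bar x_F,\bar x_G,\bar x_D$ of $\bar x=(x_1,\dots,x_n)$. Then 1. $p_F(\bar x_F)$ is finitely satisfied in $M$ but is not $M$-definable if $F\neq\emptyset$; 2. $p_G(\bar x_G)$ is generically stable over $M$; 3. $p_D(\bar x_D)$ is $M$-definable but not finitely satisfied in $M$ if $D\neq\emptyset$; 4. the three types $p_F,p_G,p_D$ are triply orthogonal, i.e., $p_F\cup p_G\cup p_D\models p$.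
   Context: $[n]=\{1,\dots,n\}$. $\mathfrak{C}$ is a monster model of $T$; ''small'' means of size less than its degree of saturation. $T$ is monadically NIP if the theory of the expansion of any model of $T$ by any number of unary predicates is NIP. A global type is a complete type over $\mathfrak{C}$; it is $M$-invariant if it is fixed by all automorphisms of $\mathfrak{C}$ fixing $M$ pointwise; it is finitely satisfied in $M$ if every formula in it is realized by a tuple from $M$; it is $M$-definable if for every $L$-formula $\varphi(\bar x,\bar z)$ the set $\{\bar c\text{ from }\mathfrak{C}:\varphi(\bar x,\bar c)\in p\}$ is defined by an $L(M)$-formula. An $M$-invariant global type is generically stable over $M$ if it is both $M$-definable and finitely satisfied in $M$. For a subsequence $\bar x'$ of $\bar x$, $p{\restriction}_{\bar x'}$ is the restriction of $p$ to formulas whose free variables are among $\bar x'$. Every $M$-invariant global 1-type in such $T$ falls into exactly one of the three classes defining $F,G,D$. Three global types $q(\bar x),r(\bar y),t(\bar z)$ are triply orthogonal if $q(\bar x)\cup r(\bar y)\cup t(\bar z)$ generates a complete type in $S_{\bar x,\bar y,\bar z}(\mathfrak{C})$. *)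

(* Defs.v *)
From mathcomp Require Import all_boot.
From mathcomp Require Import boolp classical_sets functions cardinality.

Set Implicit Arguments.
Unset Strict Implicit.
Unset Printing Implicit Defensive.

Local Open Scope classical_set_scope.
Local Open Scope card_scope.

Definition either (V W X : Type) (f : V -> X) (g : W -> X) (z : V + W) : X :=
  match z with inl x => f x | inr y => g y end.

Definition sum_map (V W V' W' : Type) (f : V -> V') (g : W -> W') :
  V + W -> V' + W' := either (inl \o f) (inr \o g).

(* One-sorted first-order logic with equality.  [formula L V] is the type of
   formulas whose free variables are among [V]; the variable bound by [Fall] is
   [None].  An L(A)-formula in the variables [V] is a [formula L (V + A)]: the
   parameters are variables that are always interpreted by themselves. *)

Record language := Language {
  fun_sym : Type;
  fun_arity : fun_sym -> nat;
  rel_sym : Type;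
  rel_arity : rel_sym -> nat }.

Inductive term (L : language) (V : Type) : Type :=
| Tvar of V
| Tapp (f : fun_sym L) of ('I_(fun_arity f) -> term L V).

Inductive formula (L : language) (V : Type) : Type :=
| Fbot
| Feq of term L V & term L V
| Frel (r : rel_sym L) of ('I_(rel_arity r) -> term L V)
| Fimp of formula L V & formula L V
| Fall of formula L (option V).

Arguments Fbot {L V}.

Definition Fneg (L : language) (V : Type) (phi : formula L V) : formula L V :=
  Fimp phi Fbot.

Fixpoint trename (L : language) (V W : Type) (f : V -> W) (t : term L V) :
    term L W :=
  match t with
  | Tvar x => Tvar L (f x)
  | Tapp g u => Tapp (fun i => trename f (u i))
  end.

Fixpoint rename (L : language) (V W : Type) (f : V -> W) (phi : formula L V) :
    formula L W :=
  match phi with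
  | Fbot => Fbot
  | Feq t u => Feq (trename f t) (trename f u)
  | Frel r u => Frel (fun i => trename f (u i))
  | Fimp phi1 phi2 => Fimp (rename f phi1) (rename f phi2)
  | Fall phi1 => Fall (rename (omap f) phi1)
  end.

Record structure (L : language) := Structure {
  carrier :> Type;
  carrier_inhabited : inhabited carrier;
  fun_int : forall f : fun_sym L, ('I_(fun_arity f) -> carrier) -> carrier;
  rel_int : forall r : rel_sym L, ('I_(rel_arity r) -> carrier) -> Prop }.

Fixpoint eval (L : language) (S : structure L) (V : Type) (v : V -> S)
    (t : term L V) : S :=
  match t with
  | Tvar x => v x
  | Tapp f u => fun_int (fun i => eval v (u i))
  end.

Fixpoint sat (L : language) (S : structure L) (V : Type) (v : V -> S)
    (phi : formula L V) : Prop :=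
  match phi with
  | Fbot => False
  | Feq t u => eval v t = eval v u
  | Frel r u => rel_int (fun i => eval v (u i))
  | Fimp phi1 phi2 => sat v phi1 -> sat v phi2
  | Fall phi1 => forall a : S, sat (oapp v a) phi1
  end.

Definition sentence (L : language) := formula L void.

Definition theory (L : language) := set (sentence L).

Definition model (L : language) (T : theory L) (S : structure L) : Prop :=
  forall phi, T phi -> sat (of_void S) phi.

Definition Th (L : language) (S : structure L) : theory L :=
  [set phi | sat (of_void S) phi].

Definition complete_theory (L : language) (T : theory L) : Prop :=
  (exists S, model T S) /\
  forall phi : sentence L,
    (forall S, model T S -> sat (of_void S) phi) \/
    (forall S, model T S -> sat (of_void S) (Fneg phi)).

Definition has_IP (L : language) (T : theory L) (k l : nat)
    (phi : formula L ('I_k + 'I_l)) : Prop :=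
  exists S : structure L, model T S /\
  exists (a : nat -> 'I_k -> S) (b : set nat -> 'I_l -> S),
    forall (i : nat) (I : set nat), sat (either (a i) (b I)) phi <-> I i.

Definition NIP (L : language) (T : theory L) : Prop :=
  forall (k l : nat) (phi : formula L ('I_k + 'I_l)), ~ has_IP T phi.

Definition add_unary (L : language) (I : Type) : language :=
  {| fun_sym := fun_sym L;
     fun_arity := @fun_arity L;
     rel_sym := rel_sym L + I;
     rel_arity := either (@rel_arity L) (fun=> 1) |}.

Definition expand_unary (L : language) (S : structure L) (I : Type)
    (U : I -> set S) : structure (add_unary L I) :=
  @Structure (add_unary L I) S (carrier_inhabited S) (@fun_int L S)
    (fun r : rel_sym L + I =>
       match r return ('I_(either (@rel_arity L) (fun=> 1) r) -> S) -> Prop with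
       | inl r' => @rel_int L S r'
       | inr i => fun v => U i (v ord0)
       end).

Definition monadically_NIP (L : language) (T : theory L) : Prop :=
  forall S : structure L, model T S ->
  forall (I : Type) (U : I -> set S), NIP (Th (expand_unary U)).

Definition elementary (L : language) (S S' : structure L) (h : S -> S') :
    Prop :=
  forall (V : Type) (v : V -> S) (phi : formula L V),
    sat v phi <-> sat (h \o v) phi.

Record substructure (L : language) (S : structure L) := Substructure {
  subset_of :> set S;
  subset_of_inhabited : inhabited subset_of;
  subset_of_closed : forall (f : fun_sym L) (v : 'I_(fun_arity f) -> S),
    (forall i, v i \in subset_of) -> fun_int v \in subset_of }.

Definition induced (L : language) (S : structure L) (M : substructure S) :
    structure L :=
  @Structure L (set_type M) (subset_of_inhabited M)
    (fun f v => exist (fun x => x \in subset_of M) _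
       (subset_of_closed (fun i => valP (v i))))
    (fun r v => rel_int (fun i => val (v i))).

Definition elementary_substructure (L : language) (S : structure L)
    (M : substructure S) : Prop :=
  @elementary L (induced M) S val.

Definition automorphism (L : language) (S : structure L) (s : S -> S) : Prop :=
  [/\ bijective s,
      forall (f : fun_sym L) (v : 'I_(fun_arity f) -> S),
        s (fun_int v) = fun_int (s \o v) &
      forall (r : rel_sym L) (v : 'I_(rel_arity r) -> S),
        rel_int v <-> rel_int (s \o v)].

(* In the next definitions [e : P -> S] interprets the parameters. *)

Definition realizes (L : language) (S : structure L) (P V : Type) (e : P -> S)
    (v : V -> S) (Gamma : set (formula L (V + P))) : Prop :=
  forall phi, Gamma phi -> sat (either v e) phi.

Definition finitely_satisfiable (L : language) (S : structure L) (P V : Type)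
    (e : P -> S) (Gamma : set (formula L (V + P))) : Prop :=
  forall Delta, Delta `<=` Gamma -> finite_set Delta ->
    exists v : V -> S, realizes e v Delta.

(* Cardinals are represented by types: [small K A] is |A| < |K|. *)
Definition small (K X : Type) (A : set X) : Prop :=
  (A #<= [set: K]) /\ ~ ([set: K] #<= A).

Definition saturated (L : language) (K : Type) (S : structure L) : Prop :=
  forall (A : set S) (Gamma : set (formula L (unit + A))),
    small K A -> finitely_satisfiable (val : A -> S) Gamma ->
    exists v : unit -> S, realizes (val : A -> S) v Gamma.

Definition strongly_homogeneous (L : language) (K : Type) (S : structure L) :
    Prop :=
  forall (A : set S) (f : A -> S), small K A ->
    (forall (V : Type) (v : V -> A) (phi : formula L V),
       sat ((val : A -> S) \o v) phi <-> sat (f \o v) phi) ->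
    exists2 s : S -> S, automorphism s & forall a : A, s (val a) = f a.

Definition monster (L : language) (K : Type) (T : theory L) (C : structure L) :
    Prop :=
  [/\ model T C,
      small K [set: (nat + (fun_sym L + rel_sym L))%type],
      saturated K C &
      strongly_homogeneous K C].

Section GlobalTypes.

Context (L : language) (C : structure L).
Implicit Types (V : Type) (M : set C).

Definition global_type V (p : set (formula L (V + C))) : Prop :=
  finitely_satisfiable id p /\ forall phi, p phi \/ p (Fneg phi).

Definition invariant_type M V (p : set (formula L (V + C))) : Prop :=
  forall s : C -> C, automorphism s -> (forall m, M m -> s m = m) ->
    rename (sum_map id s) @` p = p.

Definition finitely_satisfied_in M V (p : set (formula L (V + C))) : Prop :=
  forall phi, p phi ->
    exists2 v : V -> C, (forall x, M (v x)) & sat (either v id) phi.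

Definition definable_type M V (p : set (formula L (V + C))) : Prop :=
  forall (k : nat) (phi : formula L (V + 'I_k)),
    exists psi : formula L ('I_k + M),
      [set c : 'I_k -> C | p (rename (sum_map id c) phi)] =
      [set c : 'I_k -> C | sat (either c val) psi].

Definition generically_stable M V (p : set (formula L (V + C))) : Prop :=
  definable_type M p /\ finitely_satisfied_in M p.

Definition restrict_vars V (W : set V) (p : set (formula L (V + C))) :
    set (formula L (W + C)) :=
  [set phi | p (rename (sum_map val id) phi)].

(* Entailment is modulo the elementary diagram of [C]. *)
Definition entails V (Gamma Delta : set (formula L (V + C))) : Prop :=
  forall (N : structure L) (h : C -> N), elementary h ->
  forall v : V -> N, realizes h v Gamma -> realizes h v Delta.

Definition triply_orthogonal V1 V2 V3 (q : set (formula L (V1 + C)))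
    (r : set (formula L (V2 + C))) (t : set (formula L (V3 + C))) : Prop :=
  let Gamma : set (formula L ((V1 + V2 + V3) + C)) :=
    rename (sum_map (inl \o inl) id) @` q `|`
    rename (sum_map (inl \o inr) id) @` r `|`
    rename (sum_map inr id) @` t in
  global_type [set phi | entails Gamma [set phi]].

End GlobalTypes.

Arguments restrict_vars {L C V} W p _.

(* Main.v *)
From Stdlib Require List.
Require Import Defs.
From mathcomp Require Import all_boot.
From mathcomp Require Import boolp classical_sets functions cardinality filter.
From mathcomp Require Import zify.

Set Implicit Arguments.
Unset Strict Implicit.
Unset Printing Implicit Defensive.

Local Open Scope classical_set_scope.
Local Open Scope card_scope.

(** The engine is a dichotomy: if tp(B/E) is finitely satisfied in M and c is
    a single element, then tp(B/Ec) or tp(Bc/E) is finitely satisfied in M.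
    Otherwise there are a in E, b in B and phi with phi(a, b, c), but with
    neither phi(a, b', c) nor phi(a, b', c') for b', c' in M.  Take Morley
    sequences (alpha_i) and (beta_j) of coheirs of tp(a/M) and tp(b/Ma).  For
    all s, t there is a c_st with phi(alpha_s, beta_t, c_st) such that phi
    fails when alpha_s is replaced by an earlier alpha or beta_t by a later
    beta, and whose remaining phi-type is homogeneous.  Comparing each entry
    with a neighbour then defines the pair (s, t) from c_st, and a unary
    predicate on the c_st codes any bipartite graph, which is IP.

    An invariant type is definable as soon as it commutes with every type
    finitely satisfied in M; by the dichotomy this holds for a 1-type that is
    not finitely satisfied in M.  Adding one variable at a time, the dichotomy
    also shows that finite satisfiability and definability of a tuple follow
    from those of its coordinates, and that the three parts of p are
    orthogonal.  To stay inside C, types are realized over sets M + finite. *)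

(** * Formulas and finite supports *)

(** Commuting, rather than definability, is what passes from coordinates to tuples; hence
    definability is reached through a criterion on coheirs. One device turns the dichotomy into
    statements about commuting and orthogonality. Before a coheir [a] is realized, a copy [c1] of
    the element [c] to come is placed among the parameters. If the type of [a] over [c] and these
    parameters is finitely satisfied in M, it is M-invariant and cannot tell [c] from [c1]; so [a],
    generic over [c1] by construction, is generic over [c]. The other alternative is excluded by
    further parameters placed in advance, or lets [a] and [c] exchange roles. Since a global type
    need not be realized in C, orthogonality is read as follows: the copies and witnesses form a
    larger set E', and the realizations are taken over E'. Monadic NIP enters through the grid
    alone; everything after the dichotomy uses only its statement. *)

Definition elem X (A : set X) x (Ax : A x) : A := exist (fun x => x \in A) x (mem_set Ax).

Lemma In_mem (X : eqType) (x : X) (s : seq X) : List.In x s <-> x \in s.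
Proof.
elim: s => //= y s IH; rewrite inE; split; first by move=> [->|/IH ->]; rewrite ?eqxx ?orbT.
by move=> /orP[/eqP ->|/IH]; [left|right].
Qed.

Section Formulas.
Context (L : language).
Implicit Types (S : structure L) (V W X : Type).

Lemma either_sum_map V W V' W' X (f : V' -> X) (g : W' -> X) (h : V -> V')
  (k : W -> W') : either f g \o sum_map h k = either (f \o h) (g \o k).
Proof. by apply/funext=> -[]. Qed.

Lemma comp_either V W X Y (f : V -> X) (g : W -> X) (h : X -> Y) :
  h \o either f g = either (h \o f) (h \o g).
Proof. by apply/funext=> -[]. Qed.

Lemma oapp_omap V W X (f : V -> W) (v : W -> X) a :
  oapp v a \o omap f = oapp (v \o f) a.
Proof. by apply/funext=> -[]. Qed.

Lemma eval_rename S V W (f : V -> W) (v : W -> S) (t : term L V) :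
  eval v (trename f t) = eval (v \o f) t.
Proof.
elim: t => [x|g u IH] //=; congr fun_int; apply/funext=> i; exact: IH.
Qed.

Lemma sat_rename S V W (f : V -> W) (v : W -> S) (phi : formula L V) :
  sat v (rename f phi) = sat (v \o f) phi.
Proof.
elim: phi W f v => {V} [V|V t u|V r u|V phi IH1 psi IH2|V phi IH] W f v //=.
- by rewrite !eval_rename.
- by congr rel_int; apply/funext=> i; rewrite eval_rename.
- by rewrite IH1 IH2.
- by apply: eq_forall => a; rewrite IH oapp_omap.
Qed.

Lemma eval_auto S (s : S -> S) V (v : V -> S) (t : term L V) :
  automorphism s -> eval (s \o v) t = s (eval v t).
Proof.
case=> _ sf _; elim: t => [x|g u IH] //=.
by rewrite sf; congr fun_int; apply/funext=> i; exact: IH.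
Qed.

Lemma sat_auto S (s : S -> S) V (v : V -> S) (phi : formula L V) :
  automorphism s -> sat (s \o v) phi = sat v phi.
Proof.
move=> sA; case: (sA) => -[s' s'K sK] _ sr.
elim: phi v => {V} [V|V t u|V r u|V phi IH1 psi IH2|V phi IH] v //=.
- rewrite !eval_auto //; apply/propext; split=> [|->] //.
  exact: (can_inj s'K).
- apply/propext; rewrite (sr r (fun i => eval v (u i))).
  suff -> : (fun i => eval (s \o v) (u i)) = s \o (fun i => eval v (u i)) by [].
  by apply/funext=> i; rewrite eval_auto.
- by rewrite IH1 IH2.
- apply/propext; split=> H a.
  + rewrite -IH (_ : s \o oapp v a = oapp (s \o v) (s a)); first exact: H.
    by apply/funext=> -[].
  + rewrite (_ : oapp (s \o v) a = s \o oapp v (s' a)) ?IH; first exact: H.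
    by apply/funext=> -[|] //=; rewrite sK.
Qed.

Definition Fand V (phi psi : formula L V) := Fneg (Fimp phi (Fneg psi)).
Definition Fiff V (phi psi : formula L V) :=
  Fand (Fimp phi psi) (Fimp psi phi).
Definition Fex V (phi : formula L (option V)) := Fneg (Fall (Fneg phi)).

Lemma sat_neg S V (v : V -> S) phi : sat v (Fneg phi) = ~ sat v phi.
Proof. by []. Qed.

Lemma sat_and S V (v : V -> S) phi psi :
  sat v (Fand phi psi) = (sat v phi /\ sat v psi).
Proof.
apply/propext => /=; split=> [|[h1 h2] h]; last exact: h.
by move=> h; split; apply: contrapT => h'; apply: h.
Qed.

Lemma sat_iff S V (v : V -> S) phi psi :
  sat v (Fiff phi psi) = (sat v phi <-> sat v psi).
Proof. by rewrite sat_and. Qed.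

Lemma sat_ex S V (v : V -> S) phi :
  sat v (Fex phi) = exists a, sat (oapp v a) phi.
Proof.
apply/propext => /=; split=> [h|[a ha] h]; last exact: (h a).
by apply: contrapT => h'; apply: h => a ha; apply: h'; exists a.
Qed.

Lemma support_term V (t : term L V) : exists s : seq V,
  forall S (v v' : V -> S), (forall x, List.In x s -> v x = v' x) ->
  eval v t = eval v' t.
Proof.
elim: t => [x|g u IH] /=.
  by exists [:: x] => S v v' /(_ x); apply; left.
have [s sP] := choice IH.
exists (flatten [seq s i | i <- enum 'I_(fun_arity g)]) => S v v' vv'.
congr fun_int; apply/funext=> i; apply: sP => x xs; apply: vv'.
have : i \in enum 'I_(fun_arity g) by rewrite mem_enum.
elim: (enum _) => //= j l IHl; rewrite inE => /orP[/eqP <-|/IHl H].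
  by apply/List.in_app_iff; left.
by apply/List.in_app_iff; right.
Qed.

Lemma support_terms V n (u : 'I_n -> term L V) : exists s : seq V,
  forall S (v v' : V -> S), (forall x, List.In x s -> v x = v' x) ->
  (fun i => eval v (u i)) = (fun i => eval v' (u i)).
Proof.
have [s sP] := choice (fun i => support_term (u i)).
exists (flatten [seq s i | i <- enum 'I_n]) => S v v' vv'.
apply/funext=> i; apply: sP => x xs; apply: vv'.
have : i \in enum 'I_n by rewrite mem_enum.
elim: (enum _) => //= j l IHl; rewrite inE => /orP[/eqP <-|/IHl H].
  by apply/List.in_app_iff; left.
by apply/List.in_app_iff; right.
Qed.

Lemma support V (phi : formula L V) : exists s : seq V,
  forall S (v v' : V -> S), (forall x, List.In x s -> v x = v' x) ->
  sat v phi = sat v' phi.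
Proof.
elim: phi => {V} [V|V t u|V r u|V phi [s1 IH1] psi [s2 IH2]|V phi [s IH]] /=.
- by exists [::].
- have [s1 h1] := support_term t; have [s2 h2] := support_term u.
  exists (s1 ++ s2) => S v v' vv'; congr (_ = _);
    by [apply: h1 => x xs; apply: vv'; apply/List.in_app_iff; left
       |apply: h2 => x xs; apply: vv'; apply/List.in_app_iff; right].
- have [s h] := support_terms u.
  by exists s => S v v' vv'; rewrite (h S v v').
- exists (s1 ++ s2) => S v v' vv'; rewrite (IH1 S v v') 1?(IH2 S v v') // => x xs;
    by apply: vv'; apply/List.in_app_iff; by [left|right].
- exists (pmap id s) => S v v' vv'; apply: eq_forall => a; apply: IH => -[x|] //=.
  move=> xs; apply: vv'; elim: s xs => [//|[y|] s IHs] /= [].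
  + by case=> ->; left.
  + by move/IHs; right.
  + by [].
  + by move/IHs.
Qed.

(** The standard finite set of variables. It is built from [option] to match [None], the variable
    bound by [Fall]: induction on [k] quantifies or adds one variable at a time. *)
Definition vars (k : nat) : Type := iter k option void.

Lemma finite_retract V (s : seq V) : exists k (i : vars k -> V) (r : V -> vars k),
  forall x, List.In x s -> i (r x) = x.
Proof.
have [[x0]|nV] := pselect (inhabited V); last first.
  have V0 (x : V) : False by apply: nV.
  by exists 0%N, (of_void V), (fun x => match V0 x with end) => x.
elim: s => [|x s [k [i [r ri]]]].
  by exists 1%N, (fun=> x0), (fun=> None).
exists k.+1, (oapp i x), (fun y => if pselect (y = x) then None else Some (r y)).
by move=> y /=; case: pselect => [yx _|yx [/esym//|/ri]] //=.
Qed.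

(** A formula sees finitely many variables, so a valuation may be filtered through a finite type by
    [i \o r] or [j \o q]. Variables and parameters are treated separately, since uses call for one
    or the other. *)
Lemma finite_variables2 V P (phi : formula L (V + P)) :
  exists k (i : vars k -> V) (r : V -> vars k) l (j : vars l -> P) (q : P -> vars l),
  (forall S (v : V -> S) (e : P -> S),
    sat (either v e) phi = sat (either (v \o (i \o r)) e) phi) /\
  (forall S (v : V -> S) (e : P -> S),
    sat (either v e) phi = sat (either v (e \o (j \o q))) phi).
Proof.
have [s sP] := support phi.
have [k [i [r ir]]] := finite_retract (pmap (fun x => if x is inl y then Some y else None) s).
have [l [j [q jq]]] := finite_retract (pmap (fun x => if x is inr y then Some y else None) s).
exists k, i, r, l, j, q; split=> S v e; apply: sP => -[x|x] xs //=; [rewrite ir //|rewrite jq //].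
- elim: s xs {ir jq} => //= -[y|y] s IHs [//|/=].
  + by case=> ->; left.
  + by move/IHs; right.
  + by move/IHs.
- elim: s xs {ir jq} => //= -[y|y] s IHs [//|/=].
  + by move/IHs.
  + by case=> ->; left.
  + by move/IHs; right.
Qed.

End Formulas.

Definition fin (V : Type) := exists k (i : vars k -> V), forall x, exists y, i y = x.

Lemma fin_vars k : fin (vars k).
Proof. by exists k, id => x; exists x. Qed.

Lemma fin_image V W (f : V -> W) : (forall x, exists y, f y = x) -> fin V -> fin W.
Proof.
move=> fs [k [i iP]]; exists k, (f \o i) => x.
by have [y <-] := fs x; have [z <-] := iP y; exists z.
Qed.

Lemma fin_list V (s : seq V) : (forall x, List.In x s) -> fin V.
Proof.
move=> sP; have [k [i [r ir]]] := finite_retract s.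
by exists k, i => x; exists (r x); apply: ir.
Qed.

Lemma fin_list_of V : fin V -> exists s : seq V, forall x, List.In x s.
Proof.
case=> k [i iP]; suff [s sP] : exists s : seq (vars k), forall x, List.In x s.
  by exists (map i s) => x; have [y <-] := iP x; exact: List.in_map.
elim: k {V i iP} => [|k [s sP]]; first by exists [::] => -[].
by exists (None :: map Some s) => -[x|]; [right; exact: List.in_map|left].
Qed.

Lemma fin_sum V W : fin V -> fin W -> fin (V + W).
Proof.
move=> /fin_list_of[s sP] /fin_list_of[t tP].
apply: (@fin_list _ (map inl s ++ map inr t)) => -[x|x]; apply/List.in_app_iff.
  by left; exact: List.in_map.
by right; exact: List.in_map.
Qed.

Lemma fin_unit : fin unit.
Proof. by apply: (@fin_list _ [:: tt]) => -[]; left. Qed.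

Lemma fin_finType (I : finType) : fin I.
Proof.
apply: (@fin_list _ (enum I)) => x; have : x \in enum I by rewrite mem_enum.
by elim: (enum I) => //= y s IH; rewrite inE => /orP[/eqP <-|/IH]; [left|right].
Qed.

Lemma fin_sub V (A : set V) : fin V -> fin A.
Proof.
move=> /fin_list_of[s sP].
pose f (x : V) : option A := match pselect (A x) with
  left h => Some (exist _ x (mem_set h)) | _ => None end.
apply: (@fin_list _ (pmap f s)) => -[x Ax].
elim: s {sP} (sP x) => //= y s IH [->|/IH]; last by case: (f y) => //= a; right.
rewrite /f; case: pselect => [h|h] /=; last by case: h; exact: set_mem.
by left; congr exist; exact: bool_irrelevance.
Qed.

(** * Ultrapowers and compactness *)

Section Ultrapower.
Context (L : language) (S : structure L) (I : Type) (U : set_system I).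
Context (UU : UltraFilter U).

Definition ueq (f g : I -> S) : Prop := U [set i | f i = g i].

Definition ucarrier := {X : set (I -> S) | exists f, X = ueq f}.

Definition uclass (f : I -> S) : ucarrier := exist _ (ueq f) (ex_intro _ f erefl).

Definition urep (x : ucarrier) : I -> S := projT1 (cid (projT2 x)).

Lemma uclass_eq f g : uclass f = uclass g <-> ueq f g.
Proof.
split=> [[] E|fg].
  have : ueq g g by rewrite /ueq (_ : [set i | _] = setT);
    [exact: filterT | apply/seteqP].
  by rewrite -{1}E.
apply: eq_exist; apply/funext=> h; apply/propext; split=> H;
  by apply: filterS (filterI fg H) => i [/= E1 E2]; congruence.
Qed.

Lemma uclassK x : uclass (urep x) = x.
Proof.
case: x => X [f Xf]; rewrite /urep /=; case: cid => g /= E.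
by apply: eq_exist; rewrite E.
Qed.

Lemma urepK f : ueq (urep (uclass f)) f.
Proof. by apply/uclass_eq; rewrite uclassK. Qed.

Lemma inhabited_ucarrier : inhabited ucarrier.
Proof. by case: (carrier_inhabited S) => x; exists; exact: (uclass (fun=> x)). Qed.

Definition ultrapower : structure L :=
  @Structure L ucarrier inhabited_ucarrier
    (fun g v => uclass (fun i => fun_int (fun j => urep (v j) i)))
    (fun r v => U [set i | rel_int (fun j => urep (v j) i)]).

Lemma ueq_family n (f g : 'I_n -> I -> S) :
  (forall j, ueq (f j) (g j)) ->
  U [set i | (fun j => f j i) = (fun j => g j i)].
Proof.
move=> fg; have : U [set i | forall j, f j i = g j i].
  by apply: filter_forall.
by apply: filterS => i /= H; apply/funext.
Qed.

Lemma eval_ultrapower V (v : V -> I -> S) (t : term L V) :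
  @eval L ultrapower V (uclass \o v) t = uclass (fun i => eval (v^~ i) t).
Proof.
elim: t => [x|g u IH] //=; apply/uclass_eq.
have : forall j, ueq (urep (@eval L ultrapower V (uclass \o v) (u j)))
                     (fun i => eval (v^~ i) (u j)).
  by move=> j; rewrite IH; exact: urepK.
by move/ueq_family; apply: filterS => i /= ->.
Qed.

Lemma ultra_imp (A B : set I) : (U A -> U B) <-> U [set i | A i -> B i].
Proof.
split=> [AB|AB UA]; last by apply: filterS (filterI AB UA) => i [/=].
have [/AB|nA] := in_ultra_setVsetC A UU.
  by apply: filterS => i ? ?.
by apply: filterS nA => i /= nAi /nAi.
Qed.

(** Los's theorem. For a universal quantifier, failure on a large set of indices gives by choice one
    counterexample per index, and their class is a counterexample in the ultrapower. *)
Lemma los V (v : V -> I -> S) (phi : formula L V) :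
  @sat L ultrapower V (uclass \o v) phi <-> U [set i | sat (v^~ i) phi].
Proof.
elim: phi v => {V} [V|V t u|V r u|V phi IH1 psi IH2|V phi IH] v /=.
- by split=> // /filter_ex[].
- by rewrite !eval_ultrapower uclass_eq.
- have : forall j, ueq (urep (@eval L ultrapower V (uclass \o v) (u j)))
                     (fun i => eval (v^~ i) (u j)).
    by move=> j; rewrite eval_ultrapower; exact: urepK.
  move/ueq_family => E; split=> H; apply: filterS (filterI E H) => i [/=].
    by move=> ->.
  by move=> <-.
- by rewrite IH1 IH2; exact: ultra_imp.
- have cons (a : I -> S) : @oapp V ultrapower (uclass \o v) (uclass a) =
      uclass \o (oapp v a) by apply/funext=> -[].
  have consi (a : I -> S) i :
    (fun x => oapp v a x i) = oapp (v^~ i) (a i) by apply/funext=> -[].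
  split=> H.
    apply: contrapT => nH.
    have [//|{}nH] := in_ultra_setVsetC [set i | forall a, sat (oapp (v^~ i) a) phi] UU.
    have /choice[a aP] : forall i, exists a,
        ~ (forall b, sat (oapp (v^~ i) b) phi) -> ~ sat (oapp (v^~ i) a) phi.
      move=> i.
      have [H'|/existsNP[a aP]] := pselect (forall b, sat (oapp (v^~ i) b) phi).
        by case: (carrier_inhabited S) => x; exists x => /(_ H').
      by exists a.
    have := H (uclass a); rewrite cons IH => Ha.
    have [i []] := filter_ex (filterI nH Ha).
    by move=> /= /aP; rewrite consi.
  move=> x; rewrite -(uclassK x) cons IH; apply: filterS H => i /= H.
  by rewrite consi.
Qed.

Definition diagonal (x : S) : ultrapower := uclass (fun=> x).

Lemma diagonal_elementary : elementary diagonal.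
Proof.
move=> V v phi; rewrite (_ : diagonal \o v = uclass \o (fun x => fun=> v x)) //.
rewrite los; split=> H.
  by apply: filterS filterT => i _; exact: H.
by case: (filter_ex H) => i Hi; exact: Hi.
Qed.

End Ultrapower.

(** The indices are the finite subsets of [Gamma], with an ultrafilter containing every cone of
    finite sets above a given one. The ultrapower provides an elementary extension of the given
    structure. *)
Lemma compactness (L : language) (S : structure L) (P V : Type) (e : P -> S)
    (Gamma : set (formula L (V + P))) :
  finitely_satisfiable e Gamma ->
  exists (N : structure L) (h : S -> N) (v : V -> N),
    elementary h /\ realizes (h \o e) v Gamma.
Proof.
move=> Gfs.
pose I := {Delta : set (formula L (V + P)) | Delta `<=` Gamma /\ finite_set Delta}.
have /choice[w wP] : forall i : I, exists w : V -> S, realizes e w (sval i).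
  by move=> [D [DG Df]]; exact: Gfs.
pose F := filter_from [set: I] (fun i : I => [set j : I | sval i `<=` sval j]).
have FP : ProperFilter F.
  apply: filter_from_proper; last by move=> i _; exists i => /=.
  apply: filter_from_filter.
    by exists (exist _ set0 (conj (@sub0set _ _) (finite_set0 _))).
  move=> [D1 [D1G D1f]] [D2 [D2G D2f]] _ _.
  have D12 : D1 `|` D2 `<=` Gamma /\ finite_set (D1 `|` D2).
    by split; [rewrite subUset|rewrite finite_setU].
  exists (exist _ (D1 `|` D2) D12) => // -[D DP] /= sD.
  by split=> x xD; apply: sD; [left|right].
have [U [UU FU]] := ultraFilterLemma FP.
exists (ultrapower S U), (@diagonal L S I U), (fun x => uclass U (fun i => w i x)).
split; first exact: diagonal_elementary.
move=> phi phiG.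
rewrite (_ : either _ _ = uclass U \o either (fun x i => w i x) (fun y i => e y)); last by apply/funext=> -[].
rewrite los; apply: FU.
have phi1 : [set phi] `<=` Gamma /\ finite_set [set phi].
  by split=> [_ -> //|]; exact: finite_set1.
exists (exist _ [set phi] phi1) => // i /= /(_ phi erefl) /wP.
by congr sat; apply/funext=> -[].
Qed.

Lemma finitely_satisfiable_conj (L : language) (S : structure L) (P V : Type)
    (e : P -> S) (Gamma : set (formula L (V + P))) :
  (forall phi psi, Gamma phi -> Gamma psi -> exists2 chi, Gamma chi &
    forall v : V -> S, sat (either v e) chi ->
      sat (either v e) phi /\ sat (either v e) psi) ->
  (forall phi, Gamma phi -> exists v : V -> S, sat (either v e) phi) ->
  finitely_satisfiable e Gamma.
Proof.
move=> Gand Gsat Delta DG Df.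
have [[phi0 Dphi0]|D0] := pselect (Delta !=set0); last first.
  case: (carrier_inhabited S) => x; exists (fun=> x) => phi Dphi.
  by case: D0; exists phi.
suff [chi Gchi chiP] : exists2 chi, Gamma chi & forall v : V -> S,
    sat (either v e) chi -> forall phi, Delta phi -> sat (either v e) phi.
  by have [v /chiP vP] := Gsat _ Gchi; exists v.
have G0 := DG _ Dphi0; move: DG; rewrite (_ : Delta = [set phi | List.In phi (sval (cid (proj1 (@finite_seqP {classic formula L (V + P)} Delta) Df)))]); last first.
  case: cid => s /= ->; apply/seteqP; split=> phi /=.
    by elim: s => //= x s IH; rewrite inE => /orP[/eqP ->|/IH]; [left|right].
  by elim: s => //= x s IH [->|/IH]; rewrite inE ?eqxx // => ->; rewrite orbT.
elim: (sval _) => /= [_|phi s IH sG]; first by exists phi0.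
have [|chi Gchi chiP] := IH; first by move=> psi ps; apply: sG; right.
have [|chi' Gchi' chi'P] := Gand phi chi _ Gchi; first by apply: sG; left.
by exists chi' => // v /chi'P[v1 /chiP v2] psi [<-//|/v2].
Qed.


(** * Smallness of M together with a finite tuple *)

Lemma infinite_setU1_le X (A : set X) (x : X) : infinite_set A -> A `|` [set x] #<= A.
Proof.
elim/Ppointed: X => X in A x *; first by rewrite !emptyE.
move=> /infiniteP/pcard_leP/injfunPex[g gA ginj].
have [Ax|nAx] := pselect (A x).
  by rewrite (_ : _ `|` _ = A)//; apply/seteqP; split=> y; [case=> // ->|left].
have gI n m : g n = g m -> n = m by apply: ginj; rewrite inE.
(* Hilbert's hotel along the sequence [g] in [A]: [x] takes the place of [g 0], and each [g n] moves
   to [g n.+1]. *)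
have /choice[f fP] : forall y, exists z,
    [\/ y = x /\ z = g 0%N, exists2 n, y = g n & z = g n.+1 |
        [/\ y <> x, forall n, g n <> y & z = y]].
  move=> y; have [->|yx] := pselect (y = x); first by exists (g 0%N); constructor 1.
  have [[n <-]|ng] := pselect (exists n, g n = y).
    by exists (g n.+1); constructor 2; exists n.
  by exists y; constructor 3; split => // n gn; apply: ng; exists n.
apply/pcard_leP/injfunPex; exists f.
  by move=> y [] Ay; have [[_ ->]|[n _ ->]|[yx _ ->]] := fP y => //; exact: gA.
have xg n : x <> g n by move=> xgn; apply: nAx; rewrite xgn; exact: gA.
move=> y z _ _; have [[-> ->]|[n -> ->]|[yx ny ->]] := fP y;
  have [[-> ->]|[m -> ->]|[zx nz ->]] := fP z => //.
- by move=> /gI.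
- by move=> /nz.
- by move=> /gI.
- by move=> /gI[->].
- by move=> /nz.
- by move=> /esym/ny.
- by move=> /esym/ny.
Qed.

Section Small.
Context (K : Type) (natK : ([set: nat] #<= [set: K])).
Context (Kunc : ~ ([set: K] #<= [set: nat])).

(** An infinite set absorbs one more point; a finite set remains countable, hence small for the
    uncountable [K]. *)
Lemma small_setU1 X (A : set X) (x : X) : small K A -> small K (A `|` [set x]).
Proof.
move=> [AK KA]; have [Af|Ainf] := pselect (finite_set A); last first.
  have le := infinite_setU1_le x Ainf.
  by split=> [|/card_le_trans/(_ le)//]; exact: card_le_trans AK.
have : finite_set (A `|` [set x]) by rewrite finite_setU; split => //; exact: finite_set1.
move=> /finite_set_countable Ac; split; first exact: card_le_trans natK.
by move=> /card_le_trans/(_ Ac).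
Qed.

Lemma small_range X V (A : set X) (f : V -> X) :
  fin V -> small K A -> small K (A `|` range f).
Proof.
case=> k [i iP] As; have -> : range f = range (f \o i).
  apply/seteqP; split=> _ [y _ <-]; last by exists (i y).
  by have [z <-] := iP y; exists z.
suff H (g : vars k -> X) : small K (A `|` range g) by exact: H.
elim: k {i iP} g => [|k IH] g.
  by rewrite (_ : range g = set0) ?setU0//; apply/seteqP; split=> // _ [[]].
rewrite (_ : A `|` range g = (A `|` range (g \o Some)) `|` [set g None]).
  by apply: small_setU1; exact: IH.
apply/seteqP; split=> y.
  by move=> [Ay|[[z|] _ <-]]; [left; left|left; right; exists z|right].
by move=> [[Ay|[z _ <-]]|->]; [left|right; exists (Some z)|right; exists None].
Qed.

End Small.

(** * Types over subsets of the monster model *)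

Section Types.
Context (L : language) (C : structure L) (M : set C).
Implicit Types (V W P Q : Type) (D E : set C) (s : C -> C).

(* [a] realizes the restriction of [p] to [E]. *)
Definition gen V (p : set (formula L (V + C))) E (a : V -> C) : Prop :=
  forall P (e : P -> C) (phi : formula L (V + P)), (forall x, E (e x)) ->
  p (rename (sum_map id e) phi) <-> sat (either a e) phi.

Definition eqtp V E (a a' : V -> C) : Prop :=
  forall P (e : P -> C) (phi : formula L (V + P)), (forall x, E (e x)) ->
  sat (either a e) phi <-> sat (either a' e) phi.

(* tp(D/E) is finitely satisfied in [M]. *)
Definition coh D E : Prop :=
  forall Q P (d : Q -> C) (e : P -> C) (phi : formula L (Q + P)),
  (forall x, D (d x)) -> (forall x, E (e x)) -> sat (either d e) phi ->
  exists2 m : Q -> C, (forall x, M (m x)) & sat (either m e) phi.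

Definition autE E s : Prop := automorphism s /\ forall x, E x -> s x = x.

(** Restriction and renaming in one: [i] may be an inclusion of variables, a constant map that picks
    one coordinate, or a map that repeats variables. *)
Definition pull V W (i : W -> V) (p : set (formula L (V + C))) :
  set (formula L (W + C)) := [set phi | p (rename (sum_map i id) phi)].

Lemma sum_map_comp V V' V'' W W' W'' (f : V -> V') (f' : V' -> V'') (g : W -> W') (g' : W' -> W'') :
  sum_map f' g' \o sum_map f g = sum_map (f' \o f) (g' \o g).
Proof. by apply/funext => -[]. Qed.

Lemma trename_comp V W X (f : V -> W) (g : W -> X) (t : term L V) :
  trename g (trename f t) = trename (g \o f) t.
Proof.
by elim: t => //= h u IH; congr Tapp; apply/funext=> i; exact: IH.
Qed.

Lemma rename_comp V W X (f : V -> W) (g : W -> X) (phi : formula L V) :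
  rename g (rename f phi) = rename (g \o f) phi.
Proof.
elim: phi W X f g => {V} [V|V t u|V r u|V phi IH1 psi IH2|V phi IH] W X f g //=.
- by rewrite !trename_comp.
- by congr Frel; apply/funext=> i; rewrite trename_comp.
- by rewrite IH1 IH2.
- by rewrite IH; congr (Fall (rename _ _)); apply/funext=> -[].
Qed.

Lemma trename_id V (t : term L V) : trename id t = t.
Proof. by elim: t => //= h u IH; congr Tapp; apply/funext=> i; exact: IH. Qed.

Lemma rename_id V (phi : formula L V) : rename id phi = phi.
Proof.
elim: phi => {V} [V|V t u|V r u|V phi IH1 psi IH2|V phi IH] //=.
- by rewrite !trename_id.
- by congr Frel; apply/funext=> i; rewrite trename_id.
- by rewrite IH1 IH2.
- by rewrite (_ : omap id = id) ?IH //; apply/funext=> -[].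
Qed.

Lemma sum_map_id V W : sum_map (@id V) (@id W) = id.
Proof. by apply/funext => -[]. Qed.

Section GlobalTypes.
Context (V : Type) (p : set (formula L (V + C))) (pG : global_type p).

Lemma global_sat phi psi chi : p phi -> p psi -> p chi -> exists a : V -> C,
  [/\ sat (either a id) phi, sat (either a id) psi & sat (either a id) chi].
Proof.
move=> p1 p2 p3; have [||a aP] := pG.1 ([set phi] `|` [set psi] `|` [set chi]).
- by move=> _ [[]|] ->.
- by rewrite !finite_setU; split; [split|]; exact: finite_set1.
by exists a; split; apply: aP; [left; left|left; right|right].
Qed.

Lemma global_neg phi : p (Fneg phi) <-> ~ p phi.
Proof.
split=> [pn pp|np]; last by case: (pG.2 phi).
by have [a [h1 h2 _]] := global_sat pn pp pp; exact: (h1 h2).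
Qed.

Lemma global_imp phi psi : p phi ->
  (forall a : V -> C, sat (either a id) phi -> sat (either a id) psi) -> p psi.
Proof.
move=> pp H; apply: contrapT => /global_neg pn.
by have [a [/H h1 h2 _]] := global_sat pp pn pn; exact: (h2 h1).
Qed.

Lemma global_eq phi psi :
  (forall a : V -> C, sat (either a id) phi = sat (either a id) psi) ->
  p phi <-> p psi.
Proof. by move=> E; split=> /global_imp; apply=> a; rewrite E. Qed.

Lemma global_and phi psi : p (Fand phi psi) <-> p phi /\ p psi.
Proof.
split=> [pp|[pp pq]].
  by split; apply: global_imp pp _ => a; rewrite sat_and => -[].
apply: contrapT => np; have pn := proj2 (global_neg _) np.
have [a [h1 h2]] := global_sat pp pq pn.
by rewrite sat_neg sat_and; apply.
Qed.

End GlobalTypes.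

Lemma sub_gen V (p : set (formula L (V + C))) E E' a : E `<=` E' ->
  gen p E' a -> gen p E a.
Proof. by move=> EE' g P e phi Ee; apply: g => x; exact: EE'. Qed.

Lemma sub_eqtp V E E' (a a' : V -> C) : E `<=` E' -> eqtp E' a a' -> eqtp E a a'.
Proof. by move=> EE' g P e phi Ee; apply: g => x; exact: EE'. Qed.

Lemma sub_coh D D' E E' : D `<=` D' -> E `<=` E' -> coh D' E' -> coh D E.
Proof.
move=> DD' EE' h Q P d e phi dD eE.
by apply: h => x; [exact: DD'|exact: EE'].
Qed.

Lemma sub_autE E E' s : E `<=` E' -> autE E' s -> autE E s.
Proof. by move=> EE' [sA sE]; split=> // x /EE'; exact: sE. Qed.

Lemma gen_pull V W (i : W -> V) p E (a : V -> C) : gen p E a -> gen (pull i p) E (a \o i).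
Proof.
move=> g P e phi Ee; rewrite /pull /= rename_comp sum_map_comp.
have := g P e (rename (sum_map i id) phi) Ee.
by rewrite rename_comp sum_map_comp sat_rename either_sum_map.
Qed.

Lemma gen_eqtp V (p : set (formula L (V + C))) E a a' :
  gen p E a -> gen p E a' -> eqtp E a a'.
Proof. by move=> g g' P e phi Ee; rewrite -g // g'. Qed.

Lemma eqtp_gen V (p : set (formula L (V + C))) E a a' :
  gen p E a -> eqtp E a a' -> gen p E a'.
Proof. by move=> g g' P e phi Ee; rewrite g // g'. Qed.

Lemma sat_autE E s P V (a : V -> C) (e : P -> C) (phi : formula L (V + P)) :
  autE E s -> (forall x, E (e x)) -> sat (either (s \o a) e) phi = sat (either a e) phi.
Proof.
move=> [sA sE] eE; rewrite -[RHS](sat_auto _ _ sA) comp_either.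
by rewrite (_ : s \o e = e) //; apply/funext=> x; exact: sE.
Qed.

Lemma autE_eqtp E s V (a : V -> C) : autE E s -> eqtp E a (s \o a).
Proof. by move=> sE P e phi eE; rewrite (sat_autE _ _ sE). Qed.

Lemma autE_inv E s : autE E s ->
  exists s', [/\ autE E s', cancel s s' & cancel s' s].
Proof.
move=> [[[s' s'K sK] sf sr] sE]; exists s'; split=> //; split; last first.
  by move=> x Ex; rewrite -{1}(sE _ Ex) s'K.
split; first by exists s.
- move=> f v; apply: (can_inj s'K); rewrite sK sf; congr fun_int.
  by apply/funext=> i /=; rewrite sK.
- move=> r v; rewrite (sr r (s' \o v)).
  by rewrite (_ : s \o (s' \o v) = v) //; apply/funext=> i /=; rewrite sK.
Qed.

Lemma autE_comp E s t : autE E s -> autE E t -> autE E (t \o s).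
Proof.
move=> [[sb sf sr] sE] [[tb tf tr] tE]; split; last by move=> x Ex /=; rewrite sE ?tE.
split; first exact: bij_comp.
- by move=> f v /=; rewrite sf tf.
- by move=> r v; rewrite (sr r v) (tr r (s \o v)).
Qed.

(** Invariance read on each tuple of parameters, the form in which it is applied to realizations. *)
Definition invt V (p : set (formula L (V + C))) : Prop :=
  forall P (e : P -> C) (phi : formula L (V + P)) s, autE M s ->
  p (rename (sum_map id e) phi) <-> p (rename (sum_map id (s \o e)) phi).

Lemma invariant_invt V (p : set (formula L (V + C))) : invariant_type M p -> invt p.
Proof.
move=> pI; suff H P (e : P -> C) (phi : formula L (V + P)) s : autE M s ->
    p (rename (sum_map id e) phi) -> p (rename (sum_map id (s \o e)) phi).
  move=> P e phi s sM; split; first exact: H.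
  have [s' [s'M sK _]] := autE_inv sM.
  by move=> /(H _ _ _ _ s'M); rewrite compA (_ : s' \o s = id) //; apply/funext.
move=> [sA sM] pp; rewrite -(pI s sA sM); exists (rename (sum_map id e) phi) => //.
by rewrite rename_comp sum_map_comp.
Qed.

Lemma gen_aut V (p : set (formula L (V + C))) E s a :
  invt p -> autE M s -> gen p E a -> gen p (s @` E) (s \o a).
Proof.
move=> pI sM g P e phi eE; have [s' [s'M sK s'K]] := autE_inv sM.
have -> : e = s \o (s' \o e) by apply/funext=> x /=; rewrite s'K.
rewrite -pI // g; last by move=> x; have [y Ey /= <-] := eE x; rewrite sK.
by rewrite -comp_either sat_auto //; case: sM.
Qed.

Lemma invt_pull V W (i : W -> V) (p : set (formula L (V + C))) : invt p -> invt (pull i p).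
Proof.
move=> pI P e phi s sM; rewrite /pull /= !rename_comp !sum_map_comp.
by have := pI P e (rename (sum_map i id) phi) s sM; rewrite !rename_comp !sum_map_comp.
Qed.

Lemma global_pull V W (i : W -> V) (p : set (formula L (V + C))) :
  global_type p -> global_type (pull i p).
Proof.
move=> [pfs pc]; split; last by move=> phi; exact: (pc (rename (sum_map i id) phi)).
move=> Delta Dp Df; have [] := pfs (rename (sum_map i id) @` Delta).
- by move=> _ [phi /Dp ? <-].
- exact: finite_image.
- move=> a aP; exists (a \o i) => phi Dphi.
  have /aP : (rename (sum_map i id) @` Delta) (rename (sum_map i id) phi) by exists phi.
  by rewrite sat_rename either_sum_map.
Qed.

Lemma fs_pull V W (i : W -> V) (p : set (formula L (V + C))) :
  finitely_satisfied_in M p -> finitely_satisfied_in M (pull i p).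
Proof.
move=> pf phi /pf [m mM h]; exists (m \o i); first by move=> x; exact: mM.
by move: h; rewrite sat_rename either_sum_map.
Qed.

Lemma definable_pull V W (i : W -> V) (p : set (formula L (V + C))) :
  definable_type M p -> definable_type M (pull i p).
Proof.
move=> pd k phi; have [psi psiP] := pd k (rename (sum_map i id) phi).
exists psi; rewrite -psiP; apply/seteqP; split=> c /=;
  by rewrite /pull /= !rename_comp !sum_map_comp.
Qed.

Lemma pull_comp V W X (i : W -> V) (j : X -> W) (p : set (formula L (V + C))) :
  pull j (pull i p) = pull (i \o j) p.
Proof.
by apply/seteqP; split=> phi; rewrite /pull /= rename_comp sum_map_comp.
Qed.

Lemma fs_gen_coh V (p : set (formula L (V + C))) E a :
  finitely_satisfied_in M p -> gen p E a -> coh (range a) E.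
Proof.
move=> pf g Q P d e phi da eE h.
have /choice[k kP] : forall x, exists y, a y = d x by move=> x; have [y _ <-] := da x; exists y.
have : sat (either a e) (rename (sum_map k id) phi).
  rewrite sat_rename either_sum_map (_ : a \o k = d) //.
  by apply/funext.
rewrite -g // => /pf[m mM hm]; exists (m \o k); first by move=> x; exact: mM.
by move: hm; rewrite rename_comp sum_map_comp sat_rename either_sum_map.
Qed.

(** The [X] part of a tuple is replaced by elements of M over [E] and the [D] part. These elements
    lie in [E], so the [D] part can then be replaced over [E]. *)
Lemma cohU D X E : coh D E -> coh X (E `|` D) -> M `<=` E -> coh (D `|` X) E.
Proof.
move=> cD cX ME Q P d e phi dD eE h.
pose D1 := [set x | D (d x)].
pose Q1 := D1; pose Q2 := ~` D1.
pose k (x : Q) : Q1 + Q2 := match pselect (D1 x) with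
  | left h => inl (exist _ x (mem_set h)) | right h => inr (exist _ x (mem_set h)) end.
pose d1 (x : Q1) : C := d (val x); pose d2 (x : Q2) : C := d (val x).
have kE (d' : Q -> C) x : either (fun x : Q1 => d' (val x)) (fun x : Q2 => d' (val x)) (k x) = d' x.
  by rewrite /k; case: pselect.
pose f (z : Q + P) : Q2 + (Q1 + P) := match z with
  inl x => match k x with inl y => inr (inl y) | inr y => inl y end
  | inr y => inr (inr y) end.
have fE (u1 : Q1 -> C) (u2 : Q2 -> C) :
    either u2 (either u1 e) \o f = either (either u1 u2 \o k) e.
  by apply/funext=> -[x|x] //=; case: (k x).
have h1 : sat (either d2 (either d1 e)) (rename f phi).
  rewrite sat_rename fE (_ : _ \o k = d) //; apply/funext=> x; exact: kE.
have [| |m2 m2M h2] := cX _ _ _ _ _ _ _ h1.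
- by move=> [x nx]; have [] := dD x => // Dx; case: (set_mem nx).
- by move=> [[x hx]|x]; [right; exact: (set_mem hx)|left; exact: eE].
pose g (z : Q2 + (Q1 + P)) : Q1 + (Q2 + P) := match z with
  inl y => inr (inl y) | inr (inl x) => inl x | inr (inr x) => inr (inr x) end.
have gE (u1 : Q1 -> C) (u2 : Q2 -> C) :
    either u1 (either u2 e) \o g = either u2 (either u1 e).
  by apply/funext=> -[|[]].
have h3 : sat (either d1 (either m2 e)) (rename g (rename f phi)).
  by rewrite sat_rename gE.
have [| |m1 m1M h4] := cD _ _ _ _ _ _ _ h3.
- by move=> [x hx]; exact: (set_mem hx).
- by move=> [x|x]; [exact/ME/m2M|exact: eE].
exists (either m1 m2 \o k); first by move=> x /=; case: (k x).
by move: h4; rewrite sat_rename gE sat_rename fE.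
Qed.

(** If [phi] separated [e] from [e'] at [d], it would separate them at some tuple [m] of M, as both
    lie in [E]. An automorphism that fixes [m] and takes [e] to [e'] forbids this. *)
Lemma coh_aut D E P (e e' : P -> C) s Q (d : Q -> C) (phi : formula L (Q + P)) :
  coh D E -> autE M s -> e' = s \o e -> (forall x, E (e x)) -> (forall x, E (e' x)) ->
  (forall x, D (d x)) -> sat (either d e) phi <-> sat (either d e') phi.
Proof.
move=> cDE sM e'E Ee Ee' Dd.
have main (e1 e2 : P -> C) psi : (forall x, E (e1 x)) -> (forall x, E (e2 x)) ->
    (forall m : Q -> C, (forall x, M (m x)) -> sat (either m e1) psi = sat (either m e2) psi) ->
    sat (either d e1) psi -> sat (either d e2) psi.
  move=> E1 E2 H h; apply: contrapT => nh.
  have [| |m mM] := cDE Q (P + P)%type d (either e1 e2)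
    (Fand (rename (sum_map id inl) psi) (Fneg (rename (sum_map id inr) psi))) Dd.
  - by case.
  - by rewrite sat_and sat_neg !sat_rename !either_sum_map.
  by rewrite sat_and sat_neg !sat_rename !either_sum_map /= H // => -[].
have eq m : (forall x, M (m x)) -> sat (either m e) phi = sat (either m e') phi.
  move=> mM; case: (sM) => sA sE; rewrite -[LHS](sat_auto _ _ sA) comp_either -e'E.
  by rewrite (_ : s \o m = m) //; apply/funext=> x; exact: sE.
by split; apply: main => // m mM; rewrite eq.
Qed.

End Types.

(** * Saturation and homogeneity for finite tuples *)

Section Monster.
Context (L : language) (K : Type) (C : structure L) (M0 : substructure C).
Context (natK : ([set: nat] #<= [set: K])) (Kunc : ~ ([set: K] #<= [set: nat])).
Context (Csat : saturated K C) (Chom : strongly_homogeneous K C).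
Context (ME : elementary_substructure M0).
Local Notation M := (subset_of M0).

Lemma tarski_vaught P (e : P -> C) (phi : formula L (option P)) :
  (forall x, M (e x)) -> sat e (Fex phi) -> exists2 m, M m & sat (oapp e m) phi.
Proof.
move=> eM.
pose e' (x : P) : induced M0 := elem (eM x).
have -> : e = val \o e' by [].
rewrite -(ME e') sat_ex => -[[m mM]] /ME h.
exists m; first exact: set_mem.
by move: h; congr sat; apply/funext=> -[].
Qed.

(** Every type over a model is finitely satisfied in it: once reduced to finitely many, the
    variables are quantified away one at a time by the Tarski-Vaught property. *)
Lemma coh_base : coh M setT M.
Proof.
move=> Q P d e phi _ eM.
have [k [i [r [_ [_ [_ [E _]]]]]]] := finite_variables2 phi.
rewrite E; suff H (psi : formula L (vars k + P)) (u : vars k -> C) : sat (either u e) psi ->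
  exists2 m : vars k -> C, (forall x, M (m x)) & sat (either m e) psi.
  move=> h; have [|m mM hm] := H (rename (sum_map r id) phi) (d \o i).
    by rewrite sat_rename either_sum_map.
  exists (m \o r); first by move=> x; exact: mM.
  by move: hm; rewrite sat_rename either_sum_map.
elim: k {i r E} psi u => [|k IH] {}phi {}d h.
  by exists d; first by case.
pose f (x : option (vars k) + P) : option (vars k + P) := match x with
  inl None => None | inl (Some y) => Some (inl y) | inr y => Some (inr y) end.
have fE (d' : vars k -> C) x : oapp (either d' e) x \o f = either (oapp d' x) e.
  by apply/funext => -[[]|].
have [|m1 m1M] := IH (Fex (rename f phi)) (d \o Some).
  rewrite sat_ex; exists (d None); rewrite sat_rename fE.
  by rewrite (_ : oapp _ _ = d) //; apply/funext=> -[].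
move=> /tarski_vaught[|m mM]; first by case.
rewrite sat_rename fE => hm; exists (oapp m1 m) => // -[]; last exact: mM.
exact: m1M.
Qed.

(** Saturation is assumed for one variable, so the coordinates of [v] are copied into C one after
    the other, each over the copies already found. *)
Lemma realize_tuple V (N : structure L) (h : C -> N) E (v : V -> N) : fin V ->
  elementary h -> small K E -> exists a : V -> C,
  forall P (e : P -> C) (phi : formula L (V + P)), (forall x, E (e x)) ->
  sat (either a e) phi <-> sat (either v (h \o e)) phi.
Proof.
move=> [k [i /choice[r ir]]] hE Es.
suff [a aP] : exists a : vars k -> C,
  forall P (e : P -> C) (phi : formula L (vars k + P)), (forall x, E (e x)) ->
  sat (either a e) phi <-> sat (either (v \o i) (h \o e)) phi.
  exists (a \o r) => P e phi eE; have := aP P e (rename (sum_map r id) phi) eE.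
  rewrite !sat_rename !either_sum_map (_ : (v \o i) \o r = v) //.
  by apply/funext => x /=; rewrite ir.
move: (v \o i) => {V v i r ir}; elim: k => [|k IH] v.
  exists (of_void C) => P e phi eE.
  rewrite (hE _ (either (of_void C) e)) comp_either.
  by rewrite (_ : h \o of_void C = v) //; apply/funext => -[].
have [a aP] := IH (v \o Some).
have E's := small_range natK Kunc a (fin_vars k) Es.
pose E' := E `|` range a.
have jE (x : E) : E' (val x) by left; exact: (set_mem (valP x)).
have jW (x : vars k) : E' (a x) by right; exists x.
pose j : vars k + E -> E' := either (fun x => elem (jW x)) (fun x => elem (jE x)).
have valj : val \o j = either a val by apply/funext=> -[].
pose w := either (v \o Some) (h \o (val : E -> C)).
(* The type of the last coordinate over [E] and the others, with these replaced by their copies [a]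
   in C. *)
pose Gamma := [set rename (sum_map id j) phi | phi in
  [set phi : formula L (unit + (vars k + E)) | sat (either (fun=> v None) w) phi]].
have [|x xP] := Csat (Gamma := Gamma) E's.
  apply: finitely_satisfiable_conj.
    move=> _ _ [phi hphi <-] [psi hpsi <-].
    exists (rename (sum_map id j) (Fand phi psi)).
      by exists (Fand phi psi); rewrite /mkset ?sat_and.
    by move=> u; rewrite !sat_rename sat_and.
  move=> _ [phi hphi <-].
  pose f : unit + (vars k + E) -> option (vars k + E) := either (fun=> None) Some.
  have : sat w (Fex (rename f phi)).
    rewrite sat_ex; exists (v None); rewrite sat_rename.
    by move: hphi; congr sat; apply/funext => -[].
  rewrite -aP; last by move=> y; exact: (set_mem (valP y)).
  rewrite sat_ex => -[x]; rewrite sat_rename => hx.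
  exists (fun=> x); rewrite sat_rename either_sum_map valj.
  by move: hx; congr sat; apply/funext => -[].
have main phi : sat (either (fun=> v None) w) phi -> sat (either x (either a val)) phi.
  move=> hphi; have /xP : Gamma (rename (sum_map id j) phi) by exists phi.
  by rewrite sat_rename either_sum_map valj.
exists (oapp a (x tt)) => P e phi eE.
pose e' (y : P) : E := elem (eE y).
pose g (z : option (vars k) + P) : unit + (vars k + E) := match z with
  inl None => inl tt | inl (Some y) => inr (inl y) | inr y => inr (inr (e' y)) end.
have g1 : either (oapp a (x tt)) e = either x (either a val) \o g.
  by apply/funext => -[[]|].
have g2 : either v (h \o e) = either (fun=> v None) w \o g.
  by apply/funext => -[[]|].
rewrite g1 g2 -!sat_rename; split; last exact: main.
by move=> hx; apply: contrapT => nh; have := main (Fneg (rename g phi)) nh; apply.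
Qed.

Lemma realize_type V (p : set (formula L (V + C))) E : fin V -> global_type p ->
  small K E -> exists a, gen p E a.
Proof.
move=> fV pG Es; have [N [h [v [hE vP]]]] := compactness pG.1.
have [a aP] := realize_tuple v fV hE Es.
exists a => P e phi eE; rewrite aP // (_ : either v (h \o e) = either v h \o sum_map id e); last first.
  by apply/funext => -[].
rewrite -sat_rename; split; first exact: vP.
move=> hp; apply: contrapT => /(proj2 (global_neg pG _)) /vP.
by apply; exact: hp.
Qed.

Lemma eqtp_aut V E (a a' : V -> C) : fin V -> small K E -> eqtp E a a' ->
  exists2 s, autE E s & s \o a = a'.
Proof.
move=> fV Es aa'; have As := small_range natK Kunc a fV Es.
set A := E `|` range a in As.
have /choice[k kP] : forall x : A, exists y : V + E, either a val y = val x.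
  move=> [x /= /set_mem[Ex|[y _ <-]]]; last by exists (inl y).
  by exists (inr (elem Ex)).
pose f (x : A) : C := either a' val (k x).
have fE X (v : X -> A) (phi : formula L X) : sat (val \o v) phi <-> sat (f \o v) phi.
  have := aa' E val (rename (k \o v) phi); rewrite !sat_rename.
  rewrite (_ : either a val \o _ = val \o v); last by apply/funext=> x; exact: kP.
  by apply=> x; exact: (set_mem (valP x)).
have [s sA sf] := Chom As (f := f) fE.
(* The type contains the equalities between entries, so [f] does not depend on the preimages chosen
   by [k]. *)
have eqf (y z : V + E) : either a val y = either a val z -> either a' val y = either a' val z.
  move=> yz; have := aa' E val (Feq (Tvar L y) (Tvar L z)) => /= H.
  by apply/H => // x; exact: (set_mem (valP x)).
exists s.
  split=> // x Ex; have Ax : A x by left.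
  rewrite -[X in s X]/(val (elem Ax)) sf /f.
  by rewrite (eqf _ (inr (elem Ex))) //= kP.
apply/funext=> y /=; have Ay : A (a y) by right; exists y.
rewrite -[X in s X]/(val (elem Ay)) sf /f.
by rewrite (eqf _ (inl y)) //= kP.
Qed.

End Monster.

(** * Global coheirs *)

Lemma sub_small K X (A B : set X) : A `<=` B -> small K B -> small K A.
Proof.
move=> /subset_card_le AB [BK KB]; split; first exact: card_le_trans BK.
by move=> /card_le_trans/(_ AB).
Qed.

Section Coheirs.
Context (L : language) (K : Type) (C : structure L) (M0 : substructure C).
Context (natK : ([set: nat] #<= [set: K])) (Kunc : ~ ([set: K] #<= [set: nat])).
Context (Csat : saturated K C) (Chom : strongly_homogeneous K C).
Context (ME : elementary_substructure M0).
Local Notation M := (subset_of M0).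

(** An ultrafilter on tuples of M containing the solution sets of the formulas of [B] defines the
    type: a formula belongs to it when it holds of almost all tuples. It is M-invariant because
    automorphisms over M fix these tuples. *)
Lemma fs_extension V (B : set (formula L (V + C))) : B !=set0 ->
  (forall phi psi, B phi -> B psi -> exists2 chi, B chi &
    forall m : V -> C, sat (either m id) chi -> sat (either m id) phi /\ sat (either m id) psi) ->
  (forall phi, B phi -> exists2 m : V -> C, (forall x, M (m x)) & sat (either m id) phi) ->
  exists q, [/\ global_type q, invt M q, finitely_satisfied_in M q & B `<=` q].
Proof.
move=> [phi0 B0] Band Bsat.
pose F := filter_from B (fun phi => [set m : V -> C | (forall x, M (m x)) /\ sat (either m id) phi]).
have FP : ProperFilter F.
  apply: filter_from_proper; last first.
    by move=> phi /Bsat[m mM h]; exists m.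
  apply: filter_from_filter; first by exists phi0.
  move=> phi psi Bphi Bpsi; have [chi Bchi chiP] := Band _ _ Bphi Bpsi.
  by exists chi => // m [mM /chiP[h1 h2]].
have [U [UU FU]] := ultraFilterLemma FP.
have UM : U [set m | forall x, M (m x)].
  by apply: FU; exists phi0 => // m [].
exists [set phi | U [set m | sat (either m id) phi]]; split.
- split; last by move=> phi; exact: in_ultra_setVsetC.
  apply: finitely_satisfiable_conj.
    move=> phi psi Uphi Upsi; exists (Fand phi psi) => [|v]; last by rewrite sat_and.
    by apply: filterS (filterI Uphi Upsi) => m [h1 h2]; rewrite /mkset sat_and.
  by move=> phi /filter_ex[m hm]; exists m.
- move=> P e phi s sM /=.
  have E m : (forall x, M (m x)) -> sat (either m id) (rename (sum_map id e) phi) =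
      sat (either m id) (rename (sum_map id (s \o e)) phi).
    move=> mM; rewrite !sat_rename !either_sum_map.
    case: (sM) => sA sE; rewrite -[LHS](sat_auto _ _ sA) comp_either.
    by rewrite (_ : s \o (m \o id) = m) //; apply/funext=> x; exact: sE.
  by split=> h; apply: filterS (filterI UM h) => m [mM]; rewrite /mkset E.
- by move=> phi h; have [m [mM hm]] := filter_ex (filterI UM h); exists m.
- by move=> phi Bphi; apply: FU; exists phi => // m [].
Qed.

Lemma coheir V E (b : V -> C) : coh M (range b) E ->
  exists q, [/\ global_type q, invt M q, finitely_satisfied_in M q & gen q E b].
Proof.
move=> cbE; pose B := [set rename (sum_map id (val : E -> C)) phi | phi in
  [set phi : formula L (V + E) | sat (either b val) phi]].
have [||phi|q [qG qI qf Bq]] := @fs_extension V B.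
- by exists (rename (sum_map id (val : E -> C)) (Fneg Fbot)); exists (Fneg Fbot).
- move=> _ _ [phi hphi <-] [psi hpsi <-]; exists (rename (sum_map id (val : E -> C)) (Fand phi psi)).
    by exists (Fand phi psi); rewrite /mkset ?sat_and.
  by move=> m; rewrite !sat_rename sat_and.
- move=> [psi hpsi <-]; have [||m mM hm] := cbE _ E b val psi _ _ hpsi.
  + by move=> x; exists x.
  + by move=> x; exact: (set_mem (valP x)).
  by exists m => //; rewrite sat_rename either_sum_map.
- exists q; split=> // P e phi eE; pose e' x := elem (eE x).
  have main psi : sat (either b e) psi -> q (rename (sum_map id e) psi).
    move=> h; apply: Bq; exists (rename (sum_map id e') psi).
      by rewrite /mkset sat_rename either_sum_map.
    by rewrite rename_comp sum_map_comp.
  split; last exact: main.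
  by move=> qphi; apply: contrapT => /(main (Fneg phi)) /(proj1 (global_neg qG _)); apply.
Qed.

(* A coheir over [E] extends to one more variable: the formula
   "exists z, theta(d, z)" has a solution m in M, and M contains a witness for z. *)
Lemma coh_lift D E c : small K (E `|` D) -> M `<=` E -> coh M D E ->
  exists2 s, autE (M `|` D) s & coh M (D `|` [set s c]) E.
Proof.
move=> EDs ME' cDE; set A := E `|` D in EDs.
have jE (x : E) : A (val x) by left; exact: (set_mem (valP x)).
have jD (x : D) : A (val x) by right; exact: (set_mem (valP x)).
have jM (x : M) : E (val x) by apply: ME'; exact: (set_mem (valP x)).
pose j : D + E -> A := either (fun x => elem (jD x)) (fun x => elem (jE x)).
have valj : val \o j = either val val by apply/funext=> -[].
pose i : D + M -> D + E := sum_map id (fun x => elem (jM x)).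
have vali : either val val \o i = either (val : D -> C) (val : M -> C) by apply/funext=> -[].
have vji (v : unit -> C) : either v val \o sum_map id (j \o i) =
  either v (either (val : D -> C) (val : M -> C)) by apply/funext=> -[|[]].
have vj (v : unit -> C) : either v val \o sum_map id j =
  either v (either (val : D -> C) (val : E -> C)) by apply/funext=> -[|[]].
(* Formulas true of all tuples of M. A [v] satisfying each of them makes the type of [D] and [v]
   over [E] finitely satisfied in M: the negation of a formula without solution in M is among
   them. *)
pose allM (psi : formula L (unit + (D + E))) := forall (m : D -> C) m',
  (forall x, M (m x)) -> M m' -> sat (either (fun=> m') (either m val)) psi.
pose at_c (theta : formula L (unit + (D + M))) := sat (either (fun=> c) (either val val)) theta.
pose chi theta psi : formula L (unit + A) :=
  Fand (rename (sum_map id (j \o i)) theta) (rename (sum_map id j) psi).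
have chiE (v : unit -> C) theta psi : sat (either v val) (chi theta psi) =
    (sat (either v (either val val)) theta /\ sat (either v (either val val)) psi).
  by rewrite sat_and !sat_rename vji vj.
pose Gamma := [set chi u.1 u.2 | u in [set u | at_c u.1 /\ allM u.2]].
have [|v vP] := Csat (Gamma := Gamma) EDs.
  apply: finitely_satisfiable_conj.
    move=> _ _ [[th1 ps1] [h1 h1'] <-] [[th2 ps2] [h2 h2'] <-].
    exists (chi (Fand th1 th2) (Fand ps1 ps2)).
      exists (Fand th1 th2, Fand ps1 ps2) => //; split; first by rewrite /at_c sat_and.
      by move=> m m' mM m'M; rewrite sat_and; split; [exact: h1'|exact: h2'].
    by move=> v; rewrite !chiE !sat_and /= => -[[? ?] [? ?]].
  move=> _ [[theta psi] [hc hM] <-]; apply: contrapT => nh.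
  pose f W (x : unit + W) : option W := if x is inr y then Some y else None.
  have fE W (w : W -> C) x : oapp w x \o @f W = either (fun=> x) w by apply/funext=> -[].
  pose th1 : formula L (D + E) := rename i (Fex (rename (@f _) theta)).
  pose th2 : formula L (D + E) := Fex (rename (@f _) (Fand (rename (sum_map id i) theta) psi)).
  have [|||m mM] := cDE D E val val (Fand th1 (Fneg th2)).
  - by move=> x; exact: (set_mem (valP x)).
  - by move=> x; exact: (set_mem (valP x)).
  - rewrite sat_and sat_neg sat_rename vali !sat_ex; split.
      by exists c; rewrite sat_rename fE.
    move=> [z]; rewrite sat_rename fE sat_and sat_rename either_sum_map vali => hz.
    by apply: nh; exists (fun=> z); rewrite chiE.
  have mi : either m val \o i = either m (val : M -> C) by apply/funext=> -[].
  rewrite sat_and sat_neg sat_rename mi => -[] /(tarski_vaught ME)[|m' m'M].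
    by move=> [x|x] //=; exact: (set_mem (valP x)).
  rewrite sat_rename fE => h1; apply; rewrite sat_ex; exists m'.
  by rewrite sat_rename fE sat_and sat_rename either_sum_map mi; split => //; exact: hM.
have v_c theta : at_c theta -> sat (either v (either val val)) theta.
  move=> h; have /vP : Gamma (chi theta (Fneg Fbot)) by exists (theta, Fneg Fbot) => //; split=> // m m' _ _ [].
  by rewrite chiE => -[].
have v_M psi : allM psi -> sat (either v (either val val)) psi.
  move=> h; have /vP : Gamma (chi (Fneg Fbot) psi) by exists (Fneg Fbot, psi) => //; split=> // -[].
  by rewrite chiE => -[].
have cv : eqtp (M `|` D) (fun _ : unit => c) v.
  move=> P e phi eMD.
  have /choice[k kP] : forall x, exists y : D + M, either val val y = e x.
    by move=> x; have [h|h] := eMD x; [exists (inr (elem h))|exists (inl (elem h))].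
  have kE : either val val \o k = e by apply/funext.
  rewrite -kE; have kE' (u : unit -> C) : sat (either u (either val val \o k)) phi =
    sat (either u (either val val)) (rename (sum_map id k) phi).
    by rewrite sat_rename either_sum_map.
  rewrite !kE'; split; first exact: v_c.
  by move=> h; apply: contrapT => /(v_c (Fneg _)); apply.
have [|s sMD /(congr1 (fun g => g tt)) /= sc] := eqtp_aut natK Kunc Chom fin_unit _ cv.
  by apply: sub_small EDs => x [/ME'|]; [left|right].
exists s => //; move=> Q P d e phi dP eE h.
have /choice[k kP] : forall x, exists y : unit + D, either v val y = d x.
  by move=> x; have [h1|->] := dP x; [exists (inr (elem h1))|exists (inl tt)].
pose e' x := elem (eE x).
pose g (x : Q + P) : unit + (D + E) := match x with
  inl y => if k y is inr z then inr (inl z) else inl tt | inr y => inr (inr (e' y)) end.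
have gE (u : unit -> C) (m : D -> C) :
    either u (either m val) \o g = either (either u m \o k) e.
  by apply/funext=> -[x|x] //=; case: (k x) => // -[].
apply: contrapT => nh.
have /v_M : allM (Fneg (rename g phi)).
  move=> m m' mM m'M; rewrite sat_neg sat_rename gE => hm; apply: nh.
  by exists (either (fun=> m') m \o k) => // x /=; case: (k x).
rewrite sat_neg sat_rename gE; apply.
by rewrite (_ : _ \o k = d) //; apply/funext.
Qed.

End Coheirs.

(** * Morley sequences *)

Inductive sublist T : seq T -> seq T -> Prop :=
| sublist_nil : sublist [::] [::]
| sublist_skip x l l' : sublist l' l -> sublist l' (x :: l)
| sublist_take x l l' : sublist l' l -> sublist (x :: l') (x :: l).

Lemma sublist_refl T (l : seq T) : sublist l l.
Proof. by elim: l => [|x l IH]; constructor. Qed.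

Lemma sublist_trans T (l1 l2 l3 : seq T) :
  sublist l1 l2 -> sublist l2 l3 -> sublist l1 l3.
Proof.
move=> s12 s23; elim: s23 l1 s12 => {l2 l3} // [x l2 l3 _ IH|x l2 l3 _ IH] l1 s.
  by constructor; exact: IH.
by inversion s; constructor; exact: IH.
Qed.

Lemma sublist_filter T (a : pred T) (l : seq T) : sublist (seq.filter a l) l.
Proof. by elim: l => /= [|x l IH]; [constructor|case: (a x); constructor]. Qed.

Lemma sublist_shorten T (l : seq T) k : (k <= size l)%N ->
  exists2 l', sublist l' l & size l' = k.
Proof.
elim: l k => [|x l IH] [|k] //= kl; first by exists [::] => //; constructor.
- by have [l' h1 h2] := IH 0%N isT; exists l' => //; constructor.
- by have [l' h1 h2] := IH k kl; exists (x :: l'); [constructor|rewrite /= h2].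
Qed.

Lemma sublist_In T (l l' : seq T) x : sublist l' l -> List.In x l' -> List.In x l.
Proof. by elim=> //= [y m m' _ IH /IH|y m m' _ IH [->|/IH]]; [right|left|right]. Qed.

Lemma homogeneous_sublist n k : exists N, forall T (l : seq T) (Q : seq (T -> Prop)),
  size l = N -> size Q = n -> exists l', [/\ sublist l' l, size l' = k &
    forall P, List.In P Q -> forall x y, List.In x l' -> List.In y l' -> P x <-> P y].
Proof.
elim: n k => [|n IH] k.
  exists k => T l [|//] lk _; exists l; split=> //; exact: sublist_refl.
have [N NP] := IH (k + k)%N; exists N => T l [//|P Q] lN [Qn].
have [l1 [l1l l1k l1Q]] := NP T l Q lN Qn.
have done b : (k <= count (fun x => `[< P x >] == b) l1)%N ->
    exists l', [/\ sublist l' l, size l' = k &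
    forall P', List.In P' (P :: Q) -> forall x y, List.In x l' -> List.In y l' -> P' x <-> P' y].
  rewrite -size_filter => /sublist_shorten[l2 l2s l2k].
  have l21 : sublist l2 l1 by apply: sublist_trans l2s _; exact: sublist_filter.
  exists l2; split=> //; first exact: sublist_trans l1l.
  move=> P' [<-|P'Q] x y x2 y2; last by apply: (l1Q P' P'Q); exact: sublist_In l21 _.
  have PE z : List.In z l2 -> `[< P z >] = b.
    move=> /(sublist_In l2s); elim: {l2 l2s l2k l21 x2 y2 l1k l1l l1Q} l1 => //= u l1 IHl.
    by case: eqP => [ub /= [<-//|]|_]; exact: IHl.
  by split=> /asboolP; rewrite PE // => Pb; apply/asboolP; rewrite PE.
have := count_predC (fun x => `[< P x >] == true) l1; rewrite l1k => E.
have [h|h] := leqP k (count (fun x => `[< P x >] == true) l1); first exact: (done true).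
apply: (done false); rewrite -(@eq_count _ (predC (fun x => `[< P x >] == true))); first by lia.
by move=> x /=; case: `[< P x >].
Qed.

Section Morley.
Context (L : language) (K : Type) (C : structure L) (M0 : substructure C).
Context (natK : ([set: nat] #<= [set: K])) (Kunc : ~ ([set: K] #<= [set: nat])).
Context (Csat : saturated K C) (Chom : strongly_homogeneous K C).
Context (ME : elementary_substructure M0).
Local Notation M := (subset_of M0).
Implicit Types (V : Type).

Definition rng V (l : seq (V -> C)) : set C := [set y | exists2 x, List.In x l & range x y].

Lemma rng_nil V : rng ([::] : seq (V -> C)) = set0.
Proof. by apply/seteqP; split=> // y []. Qed.

Lemma rng_cons V (x : V -> C) l : rng (x :: l) = rng l `|` range x.
Proof.
apply/seteqP; split=> y.
  by move=> [z [<-|zl] yz]; [right|left; exists z].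
by move=> [[z zl yz]|yx]; [exists z => //; right|exists x => //; left].
Qed.

Lemma rng_cat V (l1 l2 : seq (V -> C)) : rng (l1 ++ l2) = rng l2 `|` rng l1.
Proof.
by elim: l1 => [|x l1 IH]; rewrite ?rng_nil ?setU0 //= !rng_cons IH setUA.
Qed.

Lemma sub_rng V (l l' : seq (V -> C)) : sublist l' l -> rng l' `<=` rng l.
Proof. by move=> s y [x /(sublist_In s)]; exists x. Qed.

Lemma rng_map V (s : C -> C) (l : seq (V -> C)) : rng (map (comp s) l) = s @` rng l.
Proof.
elim: l => [|x l IH] /=; first by rewrite !rng_nil image_set0.
rewrite !rng_cons IH image_setU; congr (_ `|` _).
apply/seteqP; split=> y; first by move=> [z _ <-]; exists (x z) => //; exists z.
by move=> [_ [z _ <-] <-]; exists z.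
Qed.

Lemma small_rng V (l : seq (V -> C)) E : fin V -> small K E -> small K (E `|` rng l).
Proof.
move=> fV Es; elim: l => [|x l IH]; first by rewrite rng_nil setU0.
by rewrite rng_cons setUA; exact: small_range.
Qed.

(* The most recent element of the sequence comes first. *)
Fixpoint morley V (q : set (formula L (V + C))) (E : set C) (l : seq (V -> C)) : Prop :=
  if l is x :: l' then morley q E l' /\ gen q (E `|` rng l') x else True.

Section OneType.
Context (V : Type) (q : set (formula L (V + C))) (fV : fin V) (qG : global_type q).
Context (qI : invt M q) (qf : finitely_satisfied_in M q).

Lemma morley_exists E n : small K E -> exists2 l, size l = n & morley q E l.
Proof.
move=> Es; elim: n => [|n [l ln ml]]; first by exists [::].
have [x xP] := realize_type natK Kunc Csat fV qG (small_rng l fV Es).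
by exists (x :: l); [rewrite /= ln|].
Qed.

Lemma sub_morley E E' l : E `<=` E' -> morley q E' l -> morley q E l.
Proof.
move=> EE'; elim: l => //= x l IH [/IH ml g]; split=> //.
by apply: sub_gen g; exact: setSU.
Qed.

Lemma morley_sublist E l l' : sublist l' l -> morley q E l -> morley q E l'.
Proof.
elim=> //= {l l'} x l l' s IH [/IH ml g] //; split=> //.
by apply: sub_gen g; apply: setUS; exact: sub_rng.
Qed.

Lemma morley_cat E l1 l2 :
  morley q E (l1 ++ l2) <-> morley q E l2 /\ morley q (E `|` rng l2) l1.
Proof.
elim: l1 => [|x l1 IH] /=; first by split=> // -[].
rewrite rng_cat setUA; split; first by move=> [/IH[]].
by move=> [m2 [m1 g]]; split=> //; apply/IH.
Qed.

Lemma morley_gen E l x : morley q E l -> List.In x l -> gen q E x.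
Proof.
elim: l => //= y l IH [ml g] [<-|/(IH ml)//].
by apply: sub_gen g; exact: subsetUl.
Qed.

Lemma morley_coh E l : M `<=` E -> morley q E l -> coh M (rng l) E.
Proof.
move=> ME'; elim: l => [_|x l IH [/IH cl g]].
  rewrite rng_nil => Q P d e phi d0 eE h; exists d => // x; by case: (d0 x).
by rewrite rng_cons; apply: cohU => //; exact: fs_gen_coh g.
Qed.

Lemma morley_aut E s l : autE M s -> morley q E l ->
  morley q (s @` E) (map (comp s) l).
Proof.
move=> sM; elim: l => //= x l IH [/IH ml g]; split=> //.
by rewrite rng_map -image_setU; exact: (gen_aut qI sM g).
Qed.

(** The oldest elements are matched before the newer ones: as [q] is invariant, once the tails agree
    the two heads have the same type over [E] and the common tail. *)
Lemma morley_unique E l l' : small K E -> M `<=` E -> size l = size l' ->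
  morley q E l -> morley q E l' -> exists2 s, autE E s & map (comp s) l = l'.
Proof.
move=> Es ME'; elim: l l' => [|x l IH] [|x' l'] //.
  by move=> _ _ _; exists id => //; split => //; split=> //; exists id.
move=> /= [sz] [ml g] [ml' g']; have [s sE sl] := IH l' sz ml ml'.
have sM := sub_autE ME' sE.
have := gen_aut qI sM g; rewrite image_setU -rng_map sl.
have -> : s @` E = E.
  apply/seteqP; split=> y; first by move=> [z Ez <-]; rewrite (proj2 sE).
  by move=> Ey; exists y => //; rewrite (proj2 sE).
move=> /gen_eqtp/(_ g')/(eqtp_aut natK Kunc Chom fV (small_rng l' fV Es))[t tE tx].
exists (t \o s); first by apply: autE_comp => //; apply: sub_autE tE; exact: subsetUl.
rewrite -tx; congr (_ :: _); rewrite -sl in tE *.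
elim: (l) tE => //= y k IHk tE; congr (_ :: _).
  apply/funext => z /=; rewrite (proj2 tE) //; right; exists (s \o y); first by left.
  by exists z.
apply: IHk; apply: sub_autE tE; apply: setUS; rewrite rng_cons; exact: subsetUl.
Qed.

End OneType.
End Morley.

(** * Isolating the cells of a grid *)

Section Configuration.
Context (L : language) (K : Type) (C : structure L) (M0 : substructure C).
Context (natK : ([set: nat] #<= [set: K])) (Kunc : ~ ([set: K] #<= [set: nat])).
Context (Csat : saturated K C) (Chom : strongly_homogeneous K C).
Context (ME : elementary_substructure M0).
Local Notation M := (subset_of M0).
Context (Ms : small K M).
Context (X Y : Type) (fX : fin X) (fY : fin Y) (phi : formula L (X + (Y + unit))).
Definition holds (a : X -> C) (b : Y -> C) (c : C) : Prop :=
  sat (either a (either b (fun=> c))) phi.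
Context (a : X -> C) (b : Y -> C) (c0 : C) (cohba : coh M (range b) (M `|` range a)).
Context (abc0 : holds a b c0).
Context (no_b : forall b', (forall y, M (b' y)) -> ~ holds a b' c0).
Context (no_bc : forall b' c', (forall y, M (b' y)) -> M c' -> ~ holds a b' c').

Lemma holds_aut s x y z : automorphism s -> holds (s \o x) (s \o y) (s z) = holds x y z.
Proof.
by move=> sA; rewrite /holds -(sat_auto (either x _) phi sA) !comp_either.
Qed.

Section Sequences.
Context (q : set (formula L (Y + C))) (qG : global_type q) (qI : invt M q).
Context (qf : finitely_satisfied_in M q) (qb : gen q (M `|` range a) b).
Context (r : set (formula L (X + C))) (rG : global_type r) (rI : invt M r).
Context (rf : finitely_satisfied_in M r) (ra : gen r M a).

Lemma not_holds_base x y z : gen r M x -> (forall u, M (y u)) -> M z -> ~ holds x y z.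
Proof.
move=> gx yM zM; have [s [sA sM] sx] := eqtp_aut natK Kunc Chom fX Ms (gen_eqtp ra gx).
rewrite -sx -(sM z zM) (_ : y = s \o y); last by apply/funext=> u /=; rewrite sM.
by rewrite holds_aut //; exact: no_bc.
Qed.

(** The pair [x], [y] is conjugate to [a], [b] over M, and [z] is the image of [c0]. *)
Lemma generic_pair x y : gen r M x -> gen q (M `|` range x) y ->
  exists2 z, holds x y z & forall y', (forall u, M (y' u)) -> ~ holds x y' z.
Proof.
move=> gx gy; have [s sM sx] := eqtp_aut natK Kunc Chom fX Ms (gen_eqtp ra gx).
have := gen_aut qI sM qb.
rewrite image_setU (_ : s @` M = M); last first.
  apply/seteqP; split=> u; first by move=> [z Mz <-]; rewrite (proj2 sM).
  by move=> Mu; exists u => //; rewrite (proj2 sM).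
rewrite (_ : s @` range a = range x); last first.
  rewrite -sx; apply/seteqP; split=> u; first by move=> [_ [z _ <-] <-]; exists z.
  by move=> [z _ <-]; exists (a z) => //; exists z.
move=> /gen_eqtp/(_ gy)/(eqtp_aut natK Kunc Chom fY (small_range natK Kunc x fX Ms))[t tx ty].
have tM : autE M t by apply: sub_autE tx; exact: subsetUl.
have xt : t \o x = x by apply/funext => u /=; rewrite (proj2 tx) //; right; exists u.
have tsM := autE_comp sM tM.
exists (t (s c0)).
  by rewrite -xt -sx -ty !holds_aut //; [case: sM|case: tM].
move=> y' y'M; rewrite -xt -sx (_ : y' = t \o (s \o y')); last first.
  by apply/funext=> u; exact: (esym (proj2 tsM _ (y'M u))).
rewrite !holds_aut; [|by case: sM|by case: tM]; exact: no_b.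
Qed.

(* [c] is lifted so that everything after [aE] is a coheir over [M] and [aE];
   long stretches [aL0], [bE0] leave room for the pigeonhole principle. *)
Lemma configuration k1 k2 l1 l2 : exists aL a1 aE bL b1 bE c,
  [/\ [/\ size aL = k1, size aE = k2, size bL = l1 & size bE = l2],
      morley r M (aL ++ a1 :: aE),
      morley q (M `|` rng (aL ++ a1 :: aE)) (bL ++ b1 :: bE),
      [/\ holds a1 b1 c, forall x, List.In x aE -> ~ holds x b1 c &
        forall y, List.In y bL -> ~ holds a1 y c] &
      [/\ forall x x' y, List.In x aL -> List.In x' aL -> List.In y (bL ++ b1 :: bE) ->
            holds x y c <-> holds x' y c,
          forall x x' y, List.In x aE -> List.In x' aE -> List.In y (bL ++ b1 :: bE) ->
            holds x y c <-> holds x' y c &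
          forall y y', List.In y bE -> List.In y' bE -> holds a1 y c <-> holds a1 y' c]].
Proof.
(* [nseq] only records a length: the predicates to be made constant on [aL] are indexed by
   [bL ++ b1 :: bE], which does not exist yet. *)
have [N1 N1P] := homogeneous_sublist (size (nseq l1 tt ++ tt :: nseq l2 tt)) k1.
have [N2 N2P] := homogeneous_sublist 1 l2.
have [aE aEk maE] := morley_exists natK Kunc Csat fX rG k2 Ms.
have [a1 ga1] := realize_type natK Kunc Csat fX rG (small_rng natK Kunc aE fX Ms).
have ma1 : morley r M (a1 :: aE) by [].
have [aL0 aL0k maL0] := morley_exists natK Kunc Csat fX rG N1 (small_rng natK Kunc (a1 :: aE) fX Ms).
have ma : morley r M (aL0 ++ a1 :: aE) by apply/morley_cat.
have Eas := small_rng natK Kunc (aL0 ++ a1 :: aE) fX Ms.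
have [bE0 bE0k mbE0] := morley_exists natK Kunc Csat fY qG N2 Eas.
have [b1 gb1] := realize_type natK Kunc Csat fY qG (small_rng natK Kunc bE0 fY Eas).
have mb1 : morley q (M `|` rng (aL0 ++ a1 :: aE)) (b1 :: bE0) by [].
have MaE : M `<=` M `|` rng aE by exact: subsetUl.
pose D := rng (rcons aL0 a1) `|` rng (b1 :: bE0).
have aED : M `|` rng (aL0 ++ a1 :: aE) = (M `|` rng aE) `|` rng (rcons aL0 a1).
  by rewrite -cat_rcons rng_cat setUA.
have cohD : coh M D (M `|` rng aE).
  apply: cohU; [|rewrite -aED; apply: morley_coh mb1 => //; exact: subsetUl|by []].
  apply: (morley_coh rf) => //.
  by move: ma; rewrite -cat_rcons => /morley_cat[].
have ga1M : gen r M a1 by apply: sub_gen ga1; exact: subsetUl.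
have [||c1 hc1 nc1] := @generic_pair a1 b1 => //.
  apply: sub_gen gb1 => u [Mu|ua]; left; [by left|right].
  by exists a1 => //; apply/List.in_app_iff; right; left.
have Ds : small K ((M `|` rng aE) `|` D).
  rewrite setUA -aED; exact: small_rng.
(* The move by [s] fixes M, [a1] and [b1], hence keeps what is known of [c1], and it makes the type
   of [D] and [c] over M and [aE] finitely satisfied in M. *)
have [s sD cohDc] := coh_lift natK Kunc Csat Chom ME c1 Ds MaE cohD.
set c := s c1 in cohDc.
have a1D u : D (a1 u) by left; exists a1; [rewrite -cats1; apply/List.in_app_iff; right; left|exists u].
have b1D u : D (b1 u) by right; exists b1; [left|exists u].
have sa1 : s \o a1 = a1 by apply/funext => u /=; rewrite (proj2 sD) //; right.
have sb1 : s \o b1 = b1 by apply/funext => u /=; rewrite (proj2 sD) //; right.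
have hc : holds a1 b1 c by rewrite -sa1 -sb1 holds_aut //; case: sD.
have nc y' : (forall u, M (y' u)) -> ~ holds a1 y' c.
  move=> y'M; rewrite -sa1 (_ : y' = s \o y') ?holds_aut //; [exact: nc1|by case: sD|].
  by apply/funext=> u /=; rewrite (proj2 sD) //; left.
pose E' := (M `|` rng aE) `|` (D `|` [set c]).
have E's : small K E' by rewrite /E' setUA; exact: small_setU1.
(* [bL] is realized over [c] as well: a [y] in it with phi(a1, y, c) would give such a tuple in M,
   against [nc]. *)
have [bL bLk mbL] := morley_exists natK Kunc Csat fY qG l1 E's.
have cohall : coh M ((D `|` [set c]) `|` rng bL) (M `|` rng aE).
  by apply: cohU => //; apply: (morley_coh qf) => // u Mu; left; left.
have [bE [bEs bEk bEh]] := N2P _ bE0 [:: fun y => holds a1 y c] bE0k erefl.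
have [|aL [aLs aLk aLh]] := N1P _ aL0 [seq (fun x => holds x y c) | y <- bL ++ b1 :: bE] aL0k.
  by rewrite size_map !size_cat /= bLk bEk !size_nseq.
have inb y : List.In y (bL ++ b1 :: bE) -> forall u, ((D `|` [set c]) `|` rng bL) (y u).
  move=> /List.in_app_iff[yb|[<-|yb]] u; first by right; exists y => //; exists u.
    by left; left.
  left; left; right; exists y; last by exists u.
  by right; exact: sublist_In yb.
exists aL, a1, aE, bL, b1, bE, c; split=> //.
- apply/morley_cat; split=> //; exact: morley_sublist maL0.
- have saa : rng (aL ++ a1 :: aE) `<=` rng (aL0 ++ a1 :: aE).
    by rewrite !rng_cat; apply: setUS; exact: sub_rng.
  have sE : M `|` rng (aL ++ a1 :: aE) `<=` M `|` rng (aL0 ++ a1 :: aE) by exact: setUS.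
  apply/morley_cat; split.
    split; first by apply: morley_sublist bEs _; exact: sub_morley mbE0.
    by apply: sub_gen gb1; apply: setUSS => //; exact: sub_rng.
  apply: sub_morley mbL => u [[Mu|/saa ua]|ub]; first by left; left.
    have : (M `|` rng aE `|` rng (rcons aL0 a1)) u by rewrite -aED; right.
    by case=> [?|?]; [left|right; left; left].
  right; left; right.
  by move: ub; apply: sub_rng; constructor.
- split=> // [x xa h|y yb h].
    (* Over M and [x], the pair [b1], [c] can be replaced by elements of M, which is excluded since
       [x] is conjugate to [a]. *)
    have [|||m mM hm] := cohDc (Y + unit)%type X (either b1 (fun=> c)) x
      (rename (fun z => match z with inl z => inr z | inr z => inl z end) phi).
    + by move=> [u|u]; [left; exact: b1D|right].
    + by move=> u; right; exists x => //; exists u.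
    + rewrite sat_rename; move: h; congr sat; by apply/funext=> -[|].
    have := @not_holds_base x (m \o inl) (m (inr tt)).
    apply=> //; first exact: morley_gen maE xa.
      by move=> u; exact: mM.
    move: hm; rewrite sat_rename; congr sat; by apply/funext=> -[|[|[]]].
  have [||||m mM hm] := morley_coh qf _ mbL (Q := Y) (d := y) (e := either a1 (fun _ : unit => c))
      (phi := rename (fun z => match z with inl z => inr (inl z)
        | inr (inl z) => inl z | inr (inr z) => inr (inr z) end) phi).
  + by move=> u Mu; left; left.
  + by move=> u; exists y => //; exists u.
  + by move=> [u|u]; right; [left; exact: a1D|right].
  + rewrite sat_rename; move: h; congr sat; by apply/funext=> -[|[|]].
  apply: (nc m mM); move: hm; rewrite sat_rename; congr sat; by apply/funext=> -[|[|]].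
- split; last 1 first.
  + by move=> y y' yb y'b; apply: (bEh (fun y => holds a1 y c)) => //; left.
  + move=> x x' y xa x'a yb; apply: (aLh (fun x => holds x y c)) => //.
    by move: yb; elim: (bL ++ b1 :: bE) => //= z l IH [->|/IH]; [left|right].
  (* On [aE] homogeneity comes from invariance: its elements are conjugate over M, and what comes
     after [aE] is a coheir over it. *)
  move=> x x' y xa x'a yb.
  have [s' s'M s'x] := eqtp_aut natK Kunc Chom fX Ms
    (gen_eqtp (morley_gen maE xa) (morley_gen maE x'a)).
  have xE z : List.In z aE -> forall u, (M `|` rng aE) (z u).
    by move=> za u; right; exists z => //; exists u.
  have := @coh_aut _ _ M _ _ X x x' s' (Y + unit)%type (either y (fun=> c))
    (rename (fun z => match z with inl z => inr z | inr z => inl z end) phi)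
    cohall s'M (esym s'x) (xE x xa) (xE x' x'a).
  have fE z : either (either y (fun _ : unit => c)) z \o (fun z => match z with inl z => inr z | inr z => inl z end) =
    either z (either y (fun=> c)) by apply/funext => -[|].
  rewrite !sat_rename !fE; apply.
  by move=> [u|u]; [exact: inb|left; right].
Qed.

Definition isolates a a' b b' c : Prop :=
  [/\ holds a b c, ~ holds a' b c & ~ holds a b' c].

Lemma isolates_aut s x x' y y' z : automorphism s ->
  isolates (s \o x) (s \o x') (s \o y) (s \o y') (s z) <-> isolates x x' y y' z.
Proof. by move=> sA; rewrite /isolates !holds_aut. Qed.

Lemma nth_map_comp V (s : C -> C) (x0 : V -> C) l i : (i < size l)%N ->
  nth x0 (map (comp s) l) i = s \o nth x0 l i.
Proof. by move=> il; rewrite (nth_map x0). Qed.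

Lemma map_comp_fixed V (s : C -> C) (l : seq (V -> C)) :
  (forall u, rng l u -> s u = u) -> map (comp s) l = l.
Proof.
elim: l => //= x l IH H; congr (_ :: _).
  by apply/funext=> u; apply: H; exists x; [left|exists u].
by apply: IH => u [y yl yu]; apply: H; exists y => //; right.
Qed.

Lemma nth_In T (x0 : T) l i : (i < size l)%N -> List.In (nth x0 l i) l.
Proof. by elim: l i => [|x l IH] [|i] //= il; [left|right; exact: IH]. Qed.

(** Fixed sequences [A] and [B] serve for all cells: the configuration built for one cell has
    sequences of the same lengths, hence conjugate to [A] and [B], and its [c] is moved along. *)
Lemma finite_grid m n : exists (al : nat -> X -> C) (be : nat -> Y -> C) (ga : nat -> nat -> C),
  forall s t u v, (s < m)%N -> (t < n)%N -> (u < m)%N -> (v < n)%N ->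
  isolates (al u.*2) (al u.*2.+1) (be v.*2.+1) (be v.*2) (ga s t) <-> u = s /\ v = t.
Proof.
have [A Am mA] := morley_exists natK Kunc Csat fX rG m.*2 Ms.
have As := small_rng natK Kunc A fX Ms.
have [B Bn mB] := morley_exists natK Kunc Csat fY qG n.*2 As.
suff H s t : exists c, (s < m)%N -> (t < n)%N -> forall u v, (u < m)%N -> (v < n)%N ->
    isolates (nth a A u.*2) (nth a A u.*2.+1) (nth b B v.*2.+1) (nth b B v.*2) c <-> u = s /\ v = t.
  have /choice[ga gaP] : forall st, exists c, (st.1 < m)%N -> (st.2 < n)%N ->
    forall u v, (u < m)%N -> (v < n)%N ->
    isolates (nth a A u.*2) (nth a A u.*2.+1) (nth b B v.*2.+1) (nth b B v.*2) c <->
    u = st.1 /\ v = st.2 by move=> [s t]; exact: H.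
  exists (nth a A), (nth b B), (fun s t => ga (s, t)) => s t u v sm tn um vn.
  exact: (gaP (s, t)).
have [sm|?] := ltnP s m; last by exists c0; lia.
have [tn|?] := ltnP t n; last by exists c0; lia.
(* Heads are the most recent elements. [a1] gets the even position [s.*2], followed by its older
   neighbour, and [b1] the odd position [t.*2.+1], preceded by its newer neighbour. Every other pair
   of neighbours then lies wholly on one side. *)
have [aL [a1 [aE [bL [b1 [bE [c [[aLk aEk bLk bEk] maA mbB [P1 P2 P3] [P4 P5 P6]]]]]]]]] :=
  configuration s.*2 (m.*2 - s.*2.+1) t.*2.+1 (n.*2 - t.*2.+2).
set A' := aL ++ a1 :: aE in maA mbB; set B' := bL ++ b1 :: bE in mbB P4 P5.
have A'm : size A' = m.*2 by rewrite size_cat /= aLk aEk; lia.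
have B'n : size B' = n.*2 by rewrite size_cat /= bLk bEk; lia.
have [||s1 s1M s1A] := morley_unique natK Kunc Chom fX rI Ms _ _ maA mA => //.
  by rewrite A'm.
have s1B := morley_aut qI s1M mbB.
have s1E : s1 @` (M `|` rng A') = M `|` rng A.
  rewrite image_setU -rng_map s1A; congr (_ `|` _).
  apply/seteqP; split=> y; first by move=> [z Mz <-]; rewrite (proj2 s1M).
  by move=> My; exists y => //; rewrite (proj2 s1M).
rewrite s1E in s1B.
have [||s2 s2A s2B] := morley_unique natK Kunc Chom fY qI As _ _ s1B mB.
- exact: subsetUl.
- by rewrite size_map B'n.
have s2M : autE M s2 by apply: sub_autE s2A; exact: subsetUl.
have sM := autE_comp s1M s2M.
have sA : map (comp (s2 \o s1)) A' = A.
  rewrite (_ : map _ A' = map (comp s2) (map (comp s1) A')); last by rewrite -map_comp.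
  by rewrite s1A; apply: map_comp_fixed => u Au; apply: (proj2 s2A); right.
have sB : map (comp (s2 \o s1)) B' = B.
  by rewrite -s2B -map_comp.
exists ((s2 \o s1) c) => _ _ u v um vn.
rewrite -sA -sB !nth_map_comp ?A'm ?B'n; try lia.
rewrite isolates_aut; last by case: sM.
have inA i : (i < m.*2)%N -> List.In (nth a A' i) A' by rewrite -A'm; exact: nth_In.
have inB i : (i < n.*2)%N -> List.In (nth b B' i) B' by rewrite -B'n; exact: nth_In.
have inaL i : (i < s.*2)%N -> List.In (nth a A' i) aL.
  by move=> h; rewrite nth_cat aLk h; apply: nth_In; rewrite aLk.
have inaE i : (s.*2 < i < m.*2)%N -> List.In (nth a A' i) aE.
  move=> h; rewrite nth_cat aLk ltnNge (_ : (s.*2 <= i)%N) /=; last by lia.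
  rewrite -[(i - _)%N]prednK /=; last by lia.
  by apply: nth_In; rewrite aEk; lia.
have ina1 : nth a A' s.*2 = a1 by rewrite nth_cat aLk ltnn subnn.
have inbL i : (i < t.*2.+1)%N -> List.In (nth b B' i) bL.
  by move=> h; rewrite nth_cat bLk h; apply: nth_In; rewrite bLk.
have inbE i : (t.*2.+1 < i < n.*2)%N -> List.In (nth b B' i) bE.
  move=> h; rewrite nth_cat bLk ltnNge (_ : (t.*2.+1 <= i)%N) /=; last by lia.
  rewrite -[(i - _)%N]prednK /=; last by lia.
  by apply: nth_In; rewrite bEk; lia.
have inb1 : nth b B' t.*2.+1 = b1 by rewrite nth_cat bLk ltnn subnn.
split; last first.
  move=> [-> ->]; rewrite ina1 inb1; split=> //.
    by apply: P2; apply: inaE; lia.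
  by apply: P3; apply: inbL; lia.
move=> [h1 h2 h3].
(* For u other than s, both neighbours lie in [aL] or both in [aE], where phi cannot hold at one and
   fail at the other. *)
have us : u = s.
  have [us|us|//] := ltngtP u s; case: h2.
    apply: (proj1 (P4 (nth a A' u.*2) _ _ _ _ _) h1);
      [apply: inaL|apply: inaL|apply: inB]; lia.
  apply: (proj1 (P5 (nth a A' u.*2) _ _ _ _ _) h1);
    [apply: inaE|apply: inaE|apply: inB]; lia.
split=> //; rewrite us ina1 in h1 h3.
have [vt|vt|//] := ltngtP v t; last first.
  by case: h3; apply: (proj1 (P6 (nth b B' v.*2.+1) _ _ _) h1); apply: inbE; lia.
by case: (P3 _ _ h1); apply: inbL; lia.
Qed.

End Sequences.
End Configuration.

(** * Coding by a unary predicate *)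

Section Expansion.
Context (L : language) (I : Type).

Fixpoint tembed (V : Type) (t : term L V) : term (add_unary L I) V :=
  match t with
  | Tvar x => Tvar (add_unary L I) x
  | Tapp g u => @Tapp (add_unary L I) V g (fun i => tembed (u i))
  end.

Fixpoint embed (V : Type) (phi : formula L V) : formula (add_unary L I) V :=
  match phi with
  | Fbot => Fbot
  | Feq t u => Feq (tembed t) (tembed u)
  | Frel r u => @Frel (add_unary L I) _ (inl r) (fun i => tembed (u i))
  | Fimp phi1 phi2 => Fimp (embed phi1) (embed phi2)
  | Fall phi1 => Fall (embed phi1)
  end.

Context (S : structure L) (U : I -> set S).

Lemma eval_embed (V : Type) (v : V -> S) (t : term L V) :
  @eval (add_unary L I) (expand_unary U) V v (tembed t) = eval v t.
Proof. by elim: t => //= g u IH; congr fun_int; apply/funext=> i; exact: IH. Qed.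

Lemma sat_embed (V : Type) (v : V -> S) (phi : formula L V) :
  @sat (add_unary L I) (expand_unary U) V v (embed phi) = sat v phi.
Proof.
elim: phi v => {V} [V|V t u|V r u|V phi IH1 psi IH2|V phi IH] v //=.
- by rewrite !eval_embed.
- by congr rel_int; apply/funext=> i; rewrite eval_embed.
- by rewrite IH1 IH2.
- by apply: eq_forall => a; exact: IH.
Qed.

End Expansion.

Lemma fin_ord V : fin V -> exists k (i : 'I_k -> V) (r : V -> 'I_k), cancel r i.
Proof.
move=> /fin_list_of[s sP].
have [[x0]|nV] := pselect (inhabited V); last first.
  have V0 (x : V) : False by apply: nV.
  by exists 0%N, (fun x : 'I_0 => match notF (ltn_ord x) with end),
    (fun x => match V0 x with end) => x.
pose l : seq {classic V} := s.
have xl (x : {classic V}) : x \in l.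
  by apply/In_mem; exact: sP.
have lt (x : {classic V}) : (index x l < size l)%N by rewrite index_mem.
exists (size l), (fun i : 'I_(size l) => nth (x0 : {classic V}) l i), (fun x => Ordinal (lt x)).
by move=> x /=; rewrite nth_index.
Qed.

Section IndependenceProperty.
Context (L : language) (T : theory L) (C : structure L).
Context (Tmon : monadically_NIP T) (TC : model T C).
Context (X Y : Type) (fX : fin X) (fY : fin Y) (psi : formula L ((X + Y) + unit)).
Definition cell (x : X -> C) (y : Y -> C) (z : C) := sat (either (either x y) (fun _ : unit => z)) psi.

(* A unary predicate holding of the ga(s, t) with s in t codes membership. *)
Lemma no_grid : ~ forall m n, exists (al : nat -> X -> C) (be : nat -> Y -> C) (ga : nat -> nat -> C),
  forall s t u v, (s < m)%N -> (t < n)%N -> (u < m)%N -> (v < n)%N ->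
  cell (al u) (be v) (ga s t) <-> u = s /\ v = t.
Proof.
move=> grid.
(* Columns are indexed by all sets of naturals at once. Compactness allows this: finitely many
   conditions mention finitely many sets, which are numbered by their position in a list [Ys]. *)
pose W : Type := ((nat * X) + (set nat * Y)) + (nat * set nat).
pose at_cell (u : nat) (v : set nat) (s : nat) (t : set nat) : formula L (W + void) :=
  rename (fun z => inl (match z with
    | inl (inl x) => inl (inl (u, x)) | inl (inr y) => inl (inr (v, y))
    | inr _ => inr (s, t) end)) psi.
have atE (S : structure L) (w : W -> S) e u v s t :
  sat (either w e) (at_cell u v s t) = sat (either (either (fun x => w (inl (inl (u, x))))
    (fun y => w (inl (inr (v, y))))) (fun _ => w (inr (s, t)))) psi.
  by rewrite sat_rename; congr sat; apply/funext=> -[[]|].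
pose F u v s t := if pselect (u = s /\ v = t) then at_cell u v s t else Fneg (at_cell u v s t).
pose Gamma := [set phi | exists u v s t, phi = F u v s t].
have Gfs : finitely_satisfiable (of_void C) Gamma.
  move=> Delta DG /(@finite_seqP {classic _})[D DE].
  have [m [Ys mP]] : exists m (Ys : seq {classic (set nat)}), forall phi, List.In phi D ->
      exists u v s t, [/\ phi = F u v s t, (u < m)%N, (s < m)%N, v \in Ys & t \in Ys].
    have : forall phi, List.In phi D -> Gamma phi.
      by move=> phi /(@In_mem {classic _}) pD; apply: DG; rewrite DE.
    elim: (D) => [|phi l IH] H; first by exists 0%N, [::].
    have [|m [Ys mP]] := IH; first by move=> psi' h; apply: H; right.
    have [|u [v [s [t E]]]] := H phi; first by left.
    exists (maxn m (maxn u.+1 s.+1)), (v :: t :: Ys) => phi' [<-|/mP].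
      exists u, v, s, t; split=> //; [lia|lia|by rewrite inE eqxx|by rewrite !inE eqxx orbT].
    move=> [u' [v' [s' [t' [-> um sm vY tY]]]]]; exists u', v', s', t'; split=> //;
      [lia|lia|by rewrite !inE vY !orbT|by rewrite !inE tY !orbT].
  have [al [be [ga gr]]] := grid m (size Ys).
  pose ix (v : set nat) := index (v : {classic (set nat)}) Ys.
  exists (fun w : W => match w with
    | inl (inl (u, x)) => al u x | inl (inr (v, y)) => be (ix v) y
    | inr (s, t) => ga s (ix t) end).
  move=> phi; rewrite DE /= => pD.
  have /mP[u [v [s [t [-> um sm vY tY]]]]] : List.In phi D by apply/(@In_mem {classic _}).
  have := gr s (ix t) u (ix v) sm _ um _; rewrite !index_mem => /(_ tY vY).
  rewrite /cell /F; case: pselect => [uv|ne] H /=; rewrite ?sat_neg atE.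
    by apply/H; case: uv => -> ->.
  move=> /H[us vt]; apply: ne; split=> //.
  transitivity (nth (v : {classic (set nat)}) Ys (ix v)); first by rewrite /ix nth_index.
  by rewrite vt /ix nth_index.
have [N [h [w [hE wP]]]] := compactness Gfs.
have cellE u v s t : sat (either (either (fun x => w (inl (inl (u, x))))
    (fun y => w (inl (inr (v, y))))) (fun _ => w (inr (s, t)))) psi <-> u = s /\ v = t.
  have /wP : Gamma (F u v s t) by exists u, v, s, t.
  by rewrite /F; case: pselect => uv; rewrite ?sat_neg atE.
have TN : model T N.
  move=> phi /TC; rewrite (hE void (of_void C) phi); congr sat.
  by apply/funext => -[].
have [k [iX [rX rXK]]] := fin_ord fX; have [l [iY [rY rYK]]] := fin_ord fY.
pose U (_ : unit) := [set z | exists s t, t s /\ z = w (inr (s, t))].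
(* theta(x, y) says that some z in [U] occupies the cell of x and y. As the point at (s, t) occupies
   that cell alone, theta holds at row u and column v exactly when u belongs to v. *)
pose theta : formula (add_unary L unit) ('I_k + 'I_l) :=
  Fex (Fand (@Frel (add_unary L unit) _ (inr tt) (fun _ => Tvar _ None))
    (embed unit (rename (fun z => match z with
       | inl (inl x) => Some (inl (rX x)) | inl (inr y) => Some (inr (rY y))
       | inr _ => None end) psi))).
apply: (Tmon TN (U := U) (phi := theta)).
exists (expand_unary U); split; first by [].
exists (fun u j => w (inl (inl (u, iX j)))), (fun v j => w (inl (inr (v, iY j)))) => u v.
have aE z : @sat (add_unary L unit) (expand_unary U) _ (oapp (either (fun j => w (inl (inl (u, iX j))))
    (fun j => w (inl (inr (v, iY j))))) z)
   (embed unit (rename (fun z => match z with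
       | inl (inl x) => Some (inl (rX x)) | inl (inr y) => Some (inr (rY y))
       | inr _ => None end) psi)) = sat (either (either (fun x => w (inl (inl (u, x))))
    (fun y => w (inl (inr (v, y))))) (fun _ => z)) psi.
  rewrite (sat_embed U) sat_rename; congr sat; apply/funext=> -[[x|y]|y] //=.
    by rewrite rXK.
  by rewrite rYK.
rewrite sat_ex; split.
  move=> [z]; rewrite sat_and aE => -[/= [s [t [ts ->]]]].
  by rewrite cellE => -[-> ->].
move=> vu; exists (w (inr (u, v))); rewrite sat_and aE; split; last exact/cellE.
by exists u, v.
Qed.

End IndependenceProperty.

(** * The dichotomy *)

Section Dichotomy.
Context (L : language) (T : theory L) (K : Type) (C : structure L) (M0 : substructure C).
Context (natK : ([set: nat] #<= [set: K])) (Kunc : ~ ([set: K] #<= [set: nat])).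
Context (Csat : saturated K C) (Chom : strongly_homogeneous K C).
Context (ME : elementary_substructure M0).
Local Notation M := (subset_of M0).
Context (Ms : small K M) (Tmon : monadically_NIP T) (TC : model T C).

(** Two neighbours are packed into one doubled tuple, so that [isolates] becomes the formula of a
    grid with one tuple per row and per column. *)
Lemma finite_dichotomy X Y (fX : fin X) (fY : fin Y) (phi : formula L (X + (Y + unit)))
    (a : X -> C) (b : Y -> C) (c : C) :
  coh M (range b) (M `|` range a) -> holds phi a b c ->
  (forall b', (forall y, M (b' y)) -> ~ holds phi a b' c) ->
  ~ (forall b' c', (forall y, M (b' y)) -> M c' -> ~ holds phi a b' c').
Proof.
move=> cohba abc no_b no_bc.
have [q [qG qI qf qb]] := coheir cohba.
have [|r [rG rI rf ra]] := @coheir _ _ M0 _ M a; first exact: sub_coh (coh_base ME).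
have grid := finite_grid natK Kunc Csat Chom ME Ms fX fY abc no_b no_bc qG qI qf qb rG rI rf ra.
pose ren (i j : bool) (z : X + (Y + unit)) : ((X + X) + (Y + Y)) + unit :=
  match z with
  | inl x => inl (inl (if i then inr x else inl x))
  | inr (inl y) => inl (inr (if j then inr y else inl y))
  | inr (inr y) => inr y end.
pose psi := Fand (rename (ren false false) phi)
  (Fand (Fneg (rename (ren true false) phi)) (Fneg (rename (ren false true) phi))).
apply: (no_grid Tmon TC (fin_sum fX fX) (fin_sum fY fY) (psi := psi)) => m n.
have [al [be [ga gP]]] := grid m n.
exists (fun u => either (al u.*2) (al u.*2.+1)), (fun v => either (be v.*2.+1) (be v.*2)), ga.
move=> s t u v sm tn um vn; rewrite -(gP s t u v) //.
have E i j x x' y y' z : sat (either (either (either x x') (either y y')) (fun _ : unit => z))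
    (rename (ren i j) phi) = holds phi (if i then x' else x) (if j then y' else y) z.
  by rewrite sat_rename /holds; congr sat; apply/funext=> -[w|[w|w]] /=; [case: i|case: j|].
by rewrite /cell !sat_and !sat_neg !E /=; split=> [[? [? ?]]|[? ? ?]].
Qed.

(** Failure of the alternatives gives formulas [phi1] and [phi2]. In their conjunction the
    parameters from [E] are collected in [a0] and those from [B] in [b0]; [phi1] prevents replacing
    the [B] part alone by elements of M, and [phi2] prevents replacing it together with [c]. *)
Lemma dichotomy B E c : M `<=` E -> coh M B E ->
  coh M B (E `|` [set c]) \/ coh M (B `|` [set c]) E.
Proof.
move=> ME' cohBE; apply: contrapT => /not_orP[nB nE]; apply: nB.
move=> Q1 P1 d1 e1 phi1 d1B e1E h1; apply: contrapT => n1; apply: nE.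
move=> Q2 P2 d2 e2 phi2 d2B e2E h2; apply: contrapT => n2.
have [[y0]|Q10] := pselect (inhabited Q1); last first.
  by apply: n1; exists d1 => // x; case: Q10.
have [m0 Mm0] : exists m, M m.
  by case: (subset_of_inhabited M0) => -[m mM]; exists m; exact: set_mem.
pose eE x := `[< E (e1 x) >].
pose dB y := `[< B (d2 y) >].
(* Entries equal to [c] are rerouted by [f1] and [f2] to the last variable; [m0] and [d1 y0] merely
   fill the places they leave. *)
pose a0 : P1 + P2 -> C := either (fun x => if eE x then e1 x else m0) e2.
pose b0 : Q1 + Q2 -> C := either d1 (fun y => if dB y then d2 y else d1 y0).
pose f1 (z : Q1 + P1) : (P1 + P2) + ((Q1 + Q2) + unit) := match z with
  | inl y => inr (inl (inl y))
  | inr x => if eE x then inl (inl x) else inr (inr tt) end.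
pose f2 (z : Q2 + P2) : (P1 + P2) + ((Q1 + Q2) + unit) := match z with
  | inl y => if dB y then inr (inl (inr y)) else inr (inr tt)
  | inr x => inl (inr x) end.
have f1E (b' : Q1 + Q2 -> C) : either a0 (either b' (fun=> c)) \o f1 = either (b' \o inl) e1.
  apply/funext=> -[x|x] //=; case eEx: (eE x) => /=; rewrite ?eEx //.
  by have [/asboolP Ex|//] := e1E x; rewrite /eE Ex in eEx.
have f2E (b' : Q1 + Q2 -> C) c' : either a0 (either b' (fun=> c')) \o f2 =
    either (fun y => if dB y then b' (inr y) else c') e2.
  by apply/funext=> -[x|x] //=; case: (dB x).
pose phi := Fand (rename f1 phi1) (rename f2 phi2).
have [k [i [r [_ [_ [_ [iE _]]]]]]] := finite_variables2 phi.
(* The [b0] block is brought to the front so that it can be made finite by itself. *)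
pose swap (z : (P1 + P2) + ((Q1 + Q2) + unit)) : (Q1 + Q2) + ((P1 + P2) + unit) :=
  match z with inl x => inr (inl x) | inr (inl y) => inl y | inr (inr u) => inr (inr u) end.
have [l [j [q [_ [_ [_ [jE' _]]]]]]] := finite_variables2 (rename swap phi).
have swapE (a' : P1 + P2 -> C) (b' : Q1 + Q2 -> C) (c' : unit -> C) : either b' (either a' c') \o swap = either a' (either b' c').
  by apply/funext=> -[|[]].
have jE (a' : P1 + P2 -> C) (b' : Q1 + Q2 -> C) (c' : unit -> C) : sat (either a' (either b' c')) phi =
    sat (either a' (either (b' \o (j \o q)) c')) phi.
  by have := jE' C b' (either a' c'); rewrite !sat_rename !swapE.
pose phi0 : formula L (vars k + (vars l + unit)) := rename (sum_map r (sum_map q id)) phi.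
have phi0E (b' : vars l -> C) (c' : C) : holds phi0 (a0 \o i) b' c' =
    sat (either a0 (either (b' \o q) (fun=> c'))) phi.
  by rewrite /holds sat_rename !either_sum_map [RHS]iE.
apply: (@finite_dichotomy _ _ (fin_vars k) (fin_vars l) phi0 (a0 \o i) (b0 \o j) c).
- apply: sub_coh cohBE.
    move=> _ [y _ <-] /=; case: (j y) => z //=.
    by case dBz: (dB z) => //; exact: (asboolW dBz).
  move=> _ [/ME'//|[x _ <-]] /=; case: (i x) => z //=.
  by case eEz: (eE z); [exact: (asboolW eEz)|exact: ME'].
- rewrite phi0E -compA -jE sat_and !sat_rename f1E f2E; split=> //.
  move: h2; congr sat; congr either; apply/funext=> y /=.
  by case dBy: (dB y) => //; have [/asboolP By|//] := d2B y; rewrite /dB By in dBy.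
- move=> b' b'M; rewrite phi0E sat_and !sat_rename f1E => -[h _]; apply: n1.
  by exists ((b' \o q) \o inl) => // y; exact: b'M.
- move=> b' c' b'M c'M; rewrite phi0E sat_and !sat_rename f2E => -[_ h]; apply: n2.
  by eexists; last exact: h; move=> y /=; case: (dB y).
Qed.

End Dichotomy.

(** * Commuting types *)

Section Commuting.
Context (L : language) (K : Type) (C : structure L) (M0 : substructure C).
Context (natK : ([set: nat] #<= [set: K])) (Kunc : ~ ([set: K] #<= [set: nat])).
Context (Csat : saturated K C) (Chom : strongly_homogeneous K C).
Context (ME : elementary_substructure M0).
Local Notation M := (subset_of M0).
Context (Ms : small K M).
Implicit Types (V W P Q : Type) (E D : set C).

(** The parameter sets in use: they contain M, are small, and are closed under adding finite tuples,
    so global types in finitely many variables have realizations over them. *)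
Definition over_base E : Prop := exists k (e : vars k -> C), E = M `|` range e.

Lemma over_base_sub E : over_base E -> M `<=` E.
Proof. by move=> [k [e ->]]; exact: subsetUl. Qed.

Lemma over_base_small E : over_base E -> small K E.
Proof. by move=> [k [e ->]]; apply: small_range => //; exact: fin_vars. Qed.

Lemma over_base_range V (a : V -> C) : fin V -> over_base (M `|` range a).
Proof.
move=> [k [i iP]]; exists k, (a \o i); congr (_ `|` _); apply/seteqP; split=> _ [y _ <-].
  by have [z <-] := iP y; exists z.
by exists (i y).
Qed.

Lemma over_baseU V E (a : V -> C) : fin V -> over_base E -> over_base (E `|` range a).
Proof.
move=> fV [k [e ->]].
have -> : M `|` range e `|` range a = M `|` range (either e a).
  rewrite -setUA; congr (_ `|` _); apply/seteqP; split=> y.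
    by move=> [[x _ <-]|[x _ <-]]; [exists (inl x)|exists (inr x)].
  by move=> [[x|x] _ <-]; [left; exists x|right; exists x].
by apply: over_base_range; apply: fin_sum => //; exact: fin_vars.
Qed.

Lemma over_baseUU E E' : over_base E -> over_base E' -> over_base (E `|` E').
Proof.
move=> Eb [k [e ->]].
have -> : E `|` (M `|` range e) = E `|` range e.
  by rewrite setUA (setUidl (over_base_sub Eb)).
by apply: over_baseU => //; exact: fin_vars.
Qed.

Lemma over_baseM : over_base M.
Proof.
exists 0%N, (of_void C); rewrite [range _](_ : _ = set0) ?setU0 //.
by apply/seteqP; split=> // y [[]].
Qed.

Lemma aut_image_set E s : autE E s -> s @` E = E.
Proof.
move=> sE; apply/seteqP; split=> y; first by move=> [z Ez <-]; rewrite (proj2 sE).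
by move=> Ey; exists y => //; rewrite (proj2 sE).
Qed.

Lemma image_range V (s : C -> C) (a : V -> C) : s @` range a = range (s \o a).
Proof.
apply/seteqP; split=> y; first by move=> [_ [x _ <-] <-]; exists x.
by move=> [x _ <-]; exists (a x) => //; exists x.
Qed.

Lemma gen_autE V W (p : set (formula L (V + C))) E s (a : V -> C) (c : W -> C) :
  over_base E -> invt M p -> autE E s -> gen p (E `|` range c) a ->
  gen p (E `|` range (s \o c)) (s \o a).
Proof.
move=> Eb pI sE /(gen_aut pI (sub_autE (over_base_sub Eb) sE)).
by rewrite image_setU aut_image_set // image_range.
Qed.

Lemma gen_eqtp_range V W (p : set (formula L (V + C))) E (a : V -> C) (c c' : W -> C) :
  over_base E -> fin V -> fin W -> invt M p -> gen p (E `|` range c) a ->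
  eqtp (E `|` range a) c c' -> gen p (E `|` range c') a.
Proof.
move=> Eb fV fW pI g cc'.
have [s sE sc] := eqtp_aut natK Kunc Chom fW (over_base_small (over_baseU a fV Eb)) cc'.
have sa : s \o a = a by apply/funext=> x /=; rewrite (proj2 sE) //; right; exists x.
rewrite -sc -{1}sa; apply: gen_autE => //.
by apply: sub_autE sE; exact: subsetUl.
Qed.

(* Coheirs are M-invariant. *)
Lemma coh_eqtp W D E E' (u u' : W -> C) : over_base E -> fin W -> coh M D E' ->
  E `<=` E' -> range u `<=` E' -> range u' `<=` E' -> eqtp E u u' ->
  eqtp (E `|` D) u u'.
Proof.
move=> Eb fW cDE EE' uE' u'E' uu'.
have [s sE su] := eqtp_aut natK Kunc Chom fW (over_base_small Eb) uu'.
move=> P e phi eE.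
have /choice[k kP] : forall x, exists y : D + E, either val val y = e x.
  by move=> x; have [h|h] := eE x; [exists (inr (elem h))|exists (inl (elem h))].
pose f (z : W + P) : D + (W + E) := match z with
  inl w => inr (inl w) | inr x => match k x with inl y => inl y | inr y => inr (inr y) end end.
have fE v : either v e = either (val : D -> C) (either v (val : E -> C)) \o f.
  by apply/funext=> -[x|x] //=; rewrite -(kP x); case: (k x).
rewrite !fE -!sat_rename.
have sM := sub_autE (over_base_sub Eb) sE.
apply: (coh_aut _ cDE sM).
- rewrite comp_either su; congr either; apply/funext=> x /=.
  by rewrite (proj2 sE) //; exact: (set_mem (valP x)).
- by move=> [x|x]; [apply: uE'; exists x|apply: EE'; exact: (set_mem (valP x))].
- by move=> [x|x]; [apply: u'E'; exists x|apply: EE'; exact: (set_mem (valP x))].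
- by move=> x; exact: (set_mem (valP x)).
Qed.

(** A formula of [p] without solution in M has finitely many parameters. Placed in [E], they prevent
    every realization of [p] over [E] from being a coheir. *)
Lemma not_fs_witness V (p : set (formula L (V + C))) : global_type p ->
  ~ finitely_satisfied_in M p ->
  exists k (e0 : vars k -> C), forall E a, range e0 `<=` E -> gen p E a -> ~ coh M (range a) E.
Proof.
move=> pG /existsNP[phi /not_implyP[pphi nphi]].
have [_ [_ [_ [l [j [q [_ jE]]]]]]] := finite_variables2 phi.
exists l, j => E a jsub g cE.
have jE' (v : V -> C) : sat (either v j) (rename (sum_map id q) phi) = sat (either v id) phi.
  by rewrite sat_rename either_sum_map [RHS]jE.
have jx x : E (j x) by apply: jsub; exists x.
have : p (rename (sum_map id j) (rename (sum_map id q) phi)).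
  apply: (global_imp pG pphi) => v.
  by rewrite sat_rename either_sum_map (_ : either (v \o id) (id \o j) = either v j) // jE'.
rewrite g // => h; have [|m mM] := cE _ _ a j _ _ jx h; first by move=> x; exists x.
by rewrite jE' => hm; apply: nphi; exists m.
Qed.

(** For invariant types, this says that the products of [p] and [q] in the two orders agree. The
    reverse implication is [comm_sym]. *)
Definition comm V W (p : set (formula L (V + C))) (q : set (formula L (W + C))) : Prop :=
  forall E, over_base E -> forall a c, gen q E a -> gen p (E `|` range a) c ->
  gen q (E `|` range c) a.

Section Pair.
Context V W (p : set (formula L (V + C))) (q : set (formula L (W + C))).
Context (fV : fin V) (fW : fin W) (pG : global_type p) (qG : global_type q).
Context (pI : invt M p) (qI : invt M q).

Lemma pair_aut E a c a' c' : over_base E -> gen q E a -> gen p (E `|` range a) c ->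
  gen q E a' -> gen p (E `|` range a') c' ->
  exists s, [/\ autE E s, s \o a = a' & s \o c = c'].
Proof.
move=> Eb ga gc ga' gc'.
have [s sE sa] := eqtp_aut natK Kunc Chom fW (over_base_small Eb) (gen_eqtp ga ga').
have := gen_autE Eb pI sE gc; rewrite sa => /gen_eqtp/(_ gc').
move=> /(eqtp_aut natK Kunc Chom fV (over_base_small (over_baseU a' fW Eb)))[t tE tc].
exists (t \o s); split; last by rewrite -tc.
  by apply: autE_comp => //; apply: sub_autE tE; exact: subsetUl.
rewrite -sa; apply/funext=> x /=; rewrite (proj2 tE) //; right.
by rewrite -sa; exists x.
Qed.

Lemma comm_transfer E a c a' c' : over_base E -> gen q E a -> gen p (E `|` range a) c ->
  gen q (E `|` range c) a -> gen q E a' -> gen p (E `|` range a') c' ->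
  gen q (E `|` range c') a'.
Proof.
move=> Eb ga gc gac ga' gc'; have [s [sE <- <-]] := pair_aut Eb ga gc ga' gc'.
exact: gen_autE.
Qed.

(** All pairs realized in this order are conjugate over [E], so one pair decides. *)
Lemma comm_exists : (forall E, over_base E -> exists a c,
    [/\ gen q E a, gen p (E `|` range a) c & gen q (E `|` range c) a]) -> comm p q.
Proof.
move=> H E Eb a' c'; have [a [c [ga gc gac]]] := H E Eb; exact: comm_transfer gac.
Qed.

Lemma comm_sym E a c : comm p q -> over_base E -> gen p E c -> gen q (E `|` range c) a ->
  gen p (E `|` range a) c.
Proof.
move=> pq Eb gc ga.
have [a0 ga0] := realize_type natK Kunc Csat fW qG (over_base_small Eb).
have [c0 gc0] := realize_type natK Kunc Csat fV pG (over_base_small (over_baseU a0 fW Eb)).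
have ga0' := pq E Eb _ _ ga0 gc0.
have gc0E : gen p E c0 by apply: sub_gen gc0; exact: subsetUl.
have [s sE sc] := eqtp_aut natK Kunc Chom fV (over_base_small Eb) (gen_eqtp gc0E gc).
have := gen_autE Eb qI sE ga0'; rewrite sc => /gen_eqtp/(_ ga).
move=> /(eqtp_aut natK Kunc Chom fW (over_base_small (over_baseU c fV Eb)))[t tE ta].
have tsE : autE E (t \o s).
  by apply: autE_comp => //; apply: sub_autE tE; exact: subsetUl.
have := gen_autE Eb pI tsE gc0.
rewrite (_ : (t \o s) \o c0 = c); last first.
  rewrite -sc; apply/funext=> x /=; rewrite (proj2 tE) //; right.
  by rewrite -sc; exists x.
by rewrite (_ : (t \o s) \o a0 = a) // -ta.
Qed.

End Pair.

Lemma definable_parameters V (p : set (formula L (V + C))) : global_type p ->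
  definable_type M p -> forall P (phi : formula L (V + P)),
  exists psi : formula L (P + M), forall c : P -> C,
    p (rename (sum_map id c) phi) <-> sat (either c val) psi.
Proof.
move=> pG pd P phi.
have [_ [_ [_ [l [j [q [_ jE]]]]]]] := finite_variables2 phi.
have [k [i [r ri]]] := fin_ord (fin_vars l).
have [psi psiP] := pd k (rename (sum_map id (r \o q)) phi).
exists (rename (sum_map (j \o i) id) psi) => c.
rewrite sat_rename either_sum_map.
have := congr1 (fun X => X (c \o (j \o i))) psiP => /= <-.
rewrite rename_comp sum_map_comp.
apply: (global_eq pG) => a; rewrite !sat_rename !either_sum_map.
rewrite [LHS]jE; congr sat; congr either; apply/funext=> x /=.
by rewrite ri.
Qed.

(** Otherwise [q] contains some [psi] with parameter [c] together with the negation of [theta], the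
    formula defining when [psi] belongs to [p]. A common solution [m] in M contradicts that [c]
    realizes [p] over [E], which contains [m]. *)
Lemma definable_fs_comm V W (p : set (formula L (V + C))) (q : set (formula L (W + C))) :
  global_type p -> global_type q -> definable_type M p -> finitely_satisfied_in M q ->
  comm p q.
Proof.
move=> pG qG pd qf E Eb a c ga gc P e phi eE.
have main psi : q (rename (sum_map id e) psi) -> sat (either a e) psi; last first.
  split; first exact: main.
  by move=> h; apply: contrapT => /(proj2 (global_neg qG _)) /(main (Fneg phi)); apply.
move=> {}{phi} qpsi; apply: contrapT => nh.
have /choice[k kP] : forall x, exists y : V + E, either c val y = e x.
  by move=> x; have [h|[z _ <-]] := eE x; [exists (inr (elem h))|exists (inl z)].
pose f (z : W + P) : V + (W + E) := match z with
  inl w => inr (inl w) | inr x => match k x with inl y => inl y | inr y => inr (inr y) end end.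
have fE v : either v e = either c (either v (val : E -> C)) \o f.
  by apply/funext=> -[x|x] //=; rewrite -(kP x); case: (k x).
have [theta thetaP] := definable_parameters pG pd (rename f psi).
pose g (z : (W + E) + M) : W + (E + M) := match z with
  inl (inl w) => inl w | inl (inr x) => inr (inl x) | inr x => inr (inr x) end.
have gE v : either (either v val) val = either v (either (val : E -> C) (val : M -> C)) \o g.
  by apply/funext=> -[[]|].
have nth0 : ~ sat (either a (either (val : E -> C) (val : M -> C))) (rename g theta).
  rewrite sat_rename -gE -thetaP gc.
    by rewrite sat_rename -fE.
  by move=> [x|x]; [right; exists x|left; exact: (set_mem (valP x))].
have : q (rename (sum_map id (either (val : E -> C) (val : M -> C))) (Fneg (rename g theta))).
  rewrite ga //.
  by move=> [x|x]; [|apply: (over_base_sub Eb)]; exact: (set_mem (valP x)).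
move=> /(conj qpsi)/(proj2 (global_and qG _ _))/qf[m mM].
have E1 : sat (either m id) (rename (sum_map id (either (val : E -> C) (val : M -> C)))
    (Fneg (rename g theta))) = ~ sat (either (either m val) val) theta.
  by rewrite sat_rename either_sum_map sat_neg sat_rename gE.
rewrite sat_and E1 sat_rename either_sum_map => -[h1]; apply.
rewrite -thetaP gc.
  by rewrite sat_rename -fE.
by move=> [x|x]; left; [apply: (over_base_sub Eb); exact: mM|exact: (set_mem (valP x))].
Qed.

End Commuting.

(** * A criterion for definability *)

Lemma In_map X Y (f : X -> Y) y l : List.In y (map f l) <-> exists2 x, List.In x l & f x = y.
Proof. by split=> [/List.in_map_iff[x [? ?]]|[x xl <-]]; [exists x|exact: List.in_map]. Qed.

Section FiniteConjunctions.
Context (L : language).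

Definition For V (phi psi : formula L V) := Fimp (Fneg phi) psi.

Lemma sat_or (S : structure L) V (v : V -> S) phi psi :
  sat v (For phi psi) = (sat v phi \/ sat v psi).
Proof.
apply/propext; split=> [h|[h|h] //= /(_ h)//].
by have [|/h] := pselect (sat v phi); [left|right].
Qed.

Definition Fconj V (l : seq (formula L V)) : formula L V := foldr (@Fand L V) (Fneg Fbot) l.

Lemma sat_conj (S : structure L) V (v : V -> S) l :
  sat v (Fconj l) = forall phi, List.In phi l -> sat v phi.
Proof.
apply/propext; elim: l => [|phi l IH]; first by split=> [_ _ []|_ []].
rewrite (_ : Fconj (phi :: l) = Fand phi (Fconj l)) // sat_and; split.
  by move=> [h1 /IH h2] psi [<-|/h2].
by move=> h; split=> [|]; [|apply/IH => psi hp]; apply: h; [left|right].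
Qed.

(** A union of classes for finitely many formulas is a Boolean combination of them. [X] is cut along
    the first formula, and each part is closed under agreement on the remaining ones. *)
Lemma definable_of_finite (S : structure L) (A : set S) V (D : seq (formula L (V + A)))
    (X : set (V -> S)) :
  (forall a a', (forall th, List.In th D -> sat (either a val) th <-> sat (either a' val) th) ->
     X a -> X a') ->
  exists psi : formula L (V + A), forall c, X c <-> sat (either c val) psi.
Proof.
elim: D X => [|th D IH] X XD.
  have [[a Xa]|X0] := pselect (X !=set0).
    by exists (Fneg Fbot) => c; split=> [_ []|_]; apply: (XD a).
  by exists Fbot => c; split=> [Xc|[]]; apply: X0; exists c.
pose agree a a' := forall th', List.In th' D -> sat (either a val) th' <-> sat (either a' val) th'.
have agreeT a a' a'' : agree a a' -> agree a' a'' -> agree a a''.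
  by move=> h1 h2 th' D'; rewrite h1 // h2.
have [|p1 p1P] := IH [set c | exists a, [/\ X a, agree a c & sat (either a val) th]].
  by move=> c c' cc' [a [Xa ac h]]; exists a; split=> //; exact: agreeT cc'.
have [|p2 p2P] := IH [set c | exists a, [/\ X a, agree a c & ~ sat (either a val) th]].
  by move=> c c' cc' [a [Xa ac h]]; exists a; split=> //; exact: agreeT cc'.
exists (For (Fand th p1) (Fand (Fneg th) p2)) => c.
rewrite sat_or !sat_and [sat _ (Fneg th)]sat_neg -p1P -p2P; split.
  move=> Xc; have [h|h] := pselect (sat (either c val) th).
    by left; split=> //; exists c; split.
  by right; split=> //; exists c; split.
by move=> [] [h [a [Xa ac h']]]; apply: (XD a) => // th' [<-|/ac//]; split.
Qed.

End FiniteConjunctions.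

Section Criterion.
Context (L : language) (K : Type) (C : structure L) (M0 : substructure C).
Context (natK : ([set: nat] #<= [set: K])) (Kunc : ~ ([set: K] #<= [set: nat])).
Context (Csat : saturated K C) (Chom : strongly_homogeneous K C).
Context (ME : elementary_substructure M0).
Local Notation M := (subset_of M0).
Context (Ms : small K M).

(* If X = {z : phi(x, z) in p} were not definable, there would be two coheirs q, q'
   with the same restriction to M, phi(b, z) in q and not phi(b, z') in q' for b
   realizing p over M; commuting puts realizations of q in X and those of q' outside. *)
Lemma definable_of_comm V (p : set (formula L (V + C))) : fin V -> global_type p -> invt M p ->
  (forall k (q : set (formula L ('I_k + C))), global_type q -> invt M q ->
    finitely_satisfied_in M q -> comm M0 p q) ->
  definable_type M p.
Proof.
move=> fV pG pI pcomm k phi.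
pose X := [set c : 'I_k -> C | p (rename (sum_map id c) phi)].
apply: contrapT => ndef.
have nX (D : seq (formula L ('I_k + M))) : exists a a', [/\ X a, ~ X a' &
    forall th, List.In th D -> sat (either a val) th <-> sat (either a' val) th].
  apply: contrapT => nD; have [|psi psiP] := @definable_of_finite L C M _ D X.
    move=> a a' aa' Xa; apply: contrapT => nXa'; apply: nD; exists a, a'; split=> //.
  by apply: ndef; exists psi; apply/seteqP; split=> c /psiP.
have fk : fin 'I_k by exact: fin_finType.
have Mb := over_baseM M0.
(* The points may be taken in M: [p] commutes with a coheir of the type of [a] over M, so [a] is a
   coheir over M and a realization [c] of [p], and membership in [X] is read off [c]. *)
have inM (D : seq (formula L ('I_k + M))) a : exists m, [/\ forall x, M (m x), X m <-> X a &
    forall th, List.In th D -> sat (either m val) th <-> sat (either a val) th].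
  have [|q [qG qI qf qa]] := @coheir _ _ M0 _ M a; first exact: sub_coh (coh_base ME).
  have [c gc] := realize_type natK Kunc Csat fV pG (over_base_small natK Kunc Ms (over_baseU a fk Mb)).
  have ga := pcomm _ q qG qI qf M Mb a c qa gc.
  pose phi' : formula L ('I_k + (V + M)) := rename (fun z : V + 'I_k => match z with inl x => inr (inl x) | inr y => inl y end) phi.
  pose th' (th : formula L ('I_k + M)) : formula L ('I_k + (V + M)) := rename (sum_map id inr) th.
  pose t (th : formula L ('I_k + (V + M))) :=
    if `[< sat (either a (either c val)) th >] then th else Fneg th.
  have tP th (m : 'I_k -> C) : sat (either m (either c val)) (t th) <->
      (sat (either m (either c val)) th <-> sat (either a (either c val)) th).
    rewrite /t; case: asboolP => h /=; first by split=> // -[_]; apply.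
    by split=> [h'|h' hm]; [split|apply/h/h'].
  have [| | |m mM] := fs_gen_coh qf ga (Q := 'I_k) (P := (V + M)%type) (d := a) (e := either c val)
      (phi := Fconj (map t (phi' :: map th' D))).
  - by move=> x; exists x.
  - by move=> [x|x]; [right; exists x|left; exact: (set_mem (valP x))].
  - by rewrite sat_conj => psi /In_map[th _ <-]; apply/tP.
  rewrite sat_conj => H.
  have phiE (m' : 'I_k -> C) : sat (either m' (either c (val : M -> C))) phi' = sat (either c m') phi.
    by rewrite sat_rename; congr sat; apply/funext=> -[].
  have thE (m' : 'I_k -> C) th : sat (either m' (either c (val : M -> C))) (th' th) = sat (either m' val) th.
    by rewrite sat_rename either_sum_map.
  exists m; split=> //.
    have /tP := H (t phi') (or_introl erefl).
    by rewrite !phiE /X /= !gc // => x; [right; exists x|left].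
  move=> th thD; have : List.In (t (th' th)) (map t (phi' :: map th' D)).
    by apply/In_map; exists (th' th) => //; right; apply/In_map; exists th.
  by move=> /H/tP; rewrite !thE.
have [b gb] := realize_type natK Kunc Csat fV pG Ms.
pose ren1 (z : 'I_k + M) : ('I_k + 'I_k) + (V + M) := match z with inl x => inl (inl x) | inr y => inr (inr y) end.
pose ren2 (z : 'I_k + M) : ('I_k + 'I_k) + (V + M) := match z with inl x => inl (inr x) | inr y => inr (inr y) end.
pose ph1 (z : V + 'I_k) : ('I_k + 'I_k) + (V + M) := match z with inl x => inr (inl x) | inr y => inl (inl y) end.
pose ph2 (z : V + 'I_k) : ('I_k + 'I_k) + (V + M) := match z with inl x => inr (inl x) | inr y => inl (inr y) end.
pose chi D := Fand (Fand (rename ph1 phi) (Fneg (rename ph2 phi)))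
  (Fconj (map (fun th => Fiff (rename ren1 th) (rename ren2 th)) D)).
have chiP (m m' : 'I_k -> C) D (v : V -> C) : sat (either (either m m') (either v val)) (chi D) <->
    [/\ sat (either v m) phi, ~ sat (either v m') phi &
      forall th, List.In th D -> sat (either m val) th <-> sat (either m' val) th].
  rewrite !sat_and sat_neg !sat_rename.
  have -> : either (either m m') (either v val) \o ph1 = either v m by apply/funext=> -[].
  have -> : either (either m m') (either v val) \o ph2 = either v m' by apply/funext=> -[].
  have thE th : sat (either (either m m') (either v val)) (Fiff (rename ren1 th) (rename ren2 th)) <->
      (sat (either m val) th <-> sat (either m' val) th).
    rewrite sat_iff !sat_rename.
    have -> : either (either m m') (either v val) \o ren1 = either m val by apply/funext=> -[].
    by have -> : either (either m m') (either v val) \o ren2 = either m' val by apply/funext=> -[].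
  rewrite sat_conj; split=> [[[h1 h2] h3]|[h1 h2 h3]].
    split=> // th thD; apply/thE/h3.
    by apply/In_map; exists th.
  by split=> // psi /In_map[th /h3 h <-]; apply/thE.
(* The two coheirs are obtained as the halves of one type [Q] in doubled variables, whose formulas
   force them to agree over M. *)
pose B := [set rename (sum_map id (either b val)) (chi D) | D in [set: seq (formula L ('I_k + M))]].
have splitm (u : 'I_k + 'I_k -> C) : u = either (u \o inl) (u \o inr) by apply/funext=> -[].
have [|||Q [QG QI Qf QB]] := @fs_extension _ C M0 _ B.
- by exists (rename (sum_map id (either b val)) (chi [::])); exists [::].
- move=> _ _ [D1 _ <-] [D2 _ <-]; exists (rename (sum_map id (either b val)) (chi (D1 ++ D2))).
    by exists (D1 ++ D2).
  move=> w; rewrite !sat_rename !either_sum_map (splitm w) !chiP => -[h1 h2 h3].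
  by split; split=> // th thD; apply: h3; apply/List.in_app_iff; [left|right].
- move=> _ [D _ <-]; have [a [a' [Xa nXa' aa']]] := nX D.
  have [m [mM Xm mD]] := inM D a; have [m' [m'M Xm' m'D]] := inM D a'.
  exists (either m m'); first by case.
  rewrite sat_rename either_sum_map; apply/chiP; split.
  - by apply/(gb _ m phi mM)/Xm.
  - by move=> /(gb _ m' phi m'M)/Xm'.
  by move=> th thD; rewrite mD // m'D // aa'.
have [d gd] := realize_type natK Kunc Csat (fin_sum fk fk) QG Ms.
have gd1 := gen_pull inl gd; have gd2 := gen_pull inr gd.
have dd' : eqtp M (d \o inl) (d \o inr).
  move=> P e th eM; pose th' : formula L ('I_k + M) := rename (sum_map id (fun x => elem (eM x))) th.
  pose th0 : formula L (('I_k + 'I_k) + P) := Fiff (rename (sum_map inl id) th) (rename (sum_map inr id) th).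
  have th0E (v : 'I_k + 'I_k -> C) : sat (either v e) th0 =
      (sat (either (v \o inl) e) th <-> sat (either (v \o inr) e) th).
    by rewrite sat_iff !sat_rename !either_sum_map.
  rewrite -th0E -gd //; apply: (global_imp QG (QB _ _)); first by exists [:: th'].
  move=> v; rewrite sat_rename either_sum_map {1}(splitm v).
  move=> /chiP[_ _ /(_ th' (or_introl erefl))].
  rewrite !sat_rename !either_sum_map => h.
  by rewrite [sat _ th0](_ : _ = sat (either v e) th0) // th0E.
have [phis phisE] : exists phis : formula L ('I_k + V), forall (v : V -> C) w,
    sat (either w v) phis = sat (either v w) phi.
  exists (rename (fun z => match z with inl x => inr x | inr y => inl y end) phi) => v w.
  by rewrite sat_rename; congr sat; apply/funext=> -[].
(* If [c] realizes [p] over M and [d \o i], commuting makes [d \o i] generic over [c]. As [b] is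
   conjugate to [c] over M, whether phi(b, z) lies in the coheir is decided by whether [d \o i] lies
   in [X]. *)
have QX i : Q (rename (sum_map i b) phis) <-> X (d \o i).
  have qE (v : V -> C) : Q (rename (sum_map i v) phis) = pull i Q (rename (sum_map id v) phis).
    by rewrite /pull /= rename_comp sum_map_comp.
  have [c gc] := realize_type natK Kunc Csat fV pG
    (over_base_small natK Kunc Ms (over_baseU (d \o i) fk Mb)).
  have gdc := pcomm _ _ (global_pull i QG) (invt_pull i QI) (fs_pull Qf) M Mb _ c (gen_pull i gd) gc.
  have gcM : gen p M c by apply: sub_gen gc; exact: subsetUl.
  have [s sM <-] := eqtp_aut natK Kunc Chom fV Ms (gen_eqtp gcM gb).
  rewrite qE -(invt_pull i QI) // gdc; last by move=> x; right; exists x.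
  by rewrite phisE -gc // => x; right; exists x.
have [Q1 Q2] : Q (rename (sum_map inl b) phis) /\ ~ Q (rename (sum_map inr b) phis).
  have Qchi : Q (rename (sum_map id (either b val)) (chi [::])) by apply: QB; exists [::].
  have E (u : 'I_k + 'I_k -> C) : sat (either u id) (rename (sum_map id (either b val)) (chi [::])) ->
      sat (either u id) (rename (sum_map inl b) phis) /\
      ~ sat (either u id) (rename (sum_map inr b) phis).
    rewrite !sat_rename !either_sum_map !phisE {1}(splitm u) => /chiP[h1 h2 _].
    by split.
  split; first by apply: (global_imp QG Qchi) => u /E[].
  by apply/(global_neg QG); apply: (global_imp QG Qchi) => u /E[].
have [s sM sd] := eqtp_aut natK Kunc Chom fk Ms dd'.
by apply: Q2; apply/QX; rewrite -sd /X /= -(pI _ _ phi s sM); apply/QX.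
Qed.

End Criterion.

(** * Adding one variable at a time *)

Section Decomposition.
Context (L : language) (K : Type) (C : structure L) (M0 : substructure C).
Context (natK : ([set: nat] #<= [set: K])) (Kunc : ~ ([set: K] #<= [set: nat])).
Context (Csat : saturated K C) (Chom : strongly_homogeneous K C).
Context (ME : elementary_substructure M0).
Local Notation M := (subset_of M0).
Context (Ms : small K M).
Context (dich : forall B E c, M `<=` E -> coh M B E ->
  coh M B (E `|` [set c]) \/ coh M (B `|` [set c]) E).
Implicit Types (V W : Type) (E : set C).

Local Notation fsM := (finitely_satisfied_in M).
Local Notation const c := (fun _ : unit => c).

Lemma range_const c : range (const c) = [set c] :> set C.
Proof. by apply/seteqP; split=> y; [move=> [_ _ <-]|move=> ->; exists tt]. Qed.

Lemma range_option W (c : option W -> C) : range c = range (c \o Some) `|` [set c None].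
Proof.
apply/seteqP; split=> y.
  by move=> [[x|] _ <-]; [left; exists x|right].
by move=> [[x _ <-]|->]; [exists (Some x)|exists None].
Qed.

Lemma gen_last W (p : set (formula L (option W + C))) E (c : option W -> C) :
  gen p E c -> gen (pull (const None) p) E (const (c None)).
Proof. exact: gen_pull. Qed.

Lemma fin_option W : fin W -> fin (option W).
Proof.
move=> fW; pose f (z : W + unit) := if z is inl x then Some x else None.
apply: (fin_image (f := f)) (fin_sum fW fin_unit).
by move=> [x|]; [exists (inl x)|exists (inr tt)].
Qed.

(** [E2] contains a copy [c1] of [c] and parameters [e0] witnessing that [p] is not finitely
    satisfied in M. Because of [e0], the dichotomy makes [a] a coheir over [E2] and [c]. *)
Lemma not_fs_comm W (p : set (formula L (unit + C))) (q : set (formula L (W + C))) :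
  fin W -> global_type p -> invt M p -> ~ fsM p ->
  global_type q -> invt M q -> fsM q -> comm M0 p q.
Proof.
move=> fW pG pI pnf qG qI qf.
have [k [e0 e0P]] := not_fs_witness pG pnf.
apply: (comm_exists natK Kunc Chom Ms) => //; first exact: fin_unit.
move=> E Eb; have small_ := over_base_small natK Kunc Ms.
have [c1 gc1] := realize_type natK Kunc Csat fin_unit pG (small_ _ Eb).
have E2b := over_baseU e0 (fin_vars k) (over_baseU c1 fin_unit Eb).
set E2 := E `|` range c1 `|` range e0 in E2b.
have [a ga] := realize_type natK Kunc Csat fW qG (small_ _ E2b).
have [c gc] := realize_type natK Kunc Csat fin_unit pG (small_ _ (over_baseU a fW E2b)).
have EE2 : E `<=` E2 by move=> x Ex; left; left.
exists a, c; split; first exact: sub_gen ga.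
  by apply: sub_gen gc; exact: setSU.
have cE : c = const (c tt) by apply/funext=> -[].
have rcE : range c = [set c tt] by rewrite cE range_const.
have [cac|cac] := dich (c tt) (over_base_sub E2b) (fs_gen_coh qf ga); last first.
  have gc2 : gen p E2 c by apply: sub_gen gc; exact: subsetUl.
  case: (e0P E2 c _ gc2); first exact: subsetUr.
  by apply: sub_coh cac => //; rewrite rcE; exact: subsetUr.
apply: (gen_eqtp_range natK Kunc Chom Ms Eb fW fin_unit qI (c := c1)).
  by apply: sub_gen ga; exact: subsetUl.
apply: (coh_eqtp natK Kunc Chom Ms Eb fin_unit cac).
- by apply: subset_trans EE2 _; exact: subsetUl.
- by move=> x hx; left; left; right.
- by rewrite rcE; exact: subsetUr.
- by apply: gen_eqtp gc1 _; apply: sub_gen gc => x Ex; left; exact: EE2.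
Qed.

Section Extension.
Context (W : Type) (fW : fin W) (p : set (formula L (option W + C))).
Context (pG : global_type p) (pI : invt M p).
Local Notation px := (pull Some p).
Local Notation py := (pull (const None) p).

(** If [a] is not a coheir over the whole of [c], then [a] with the last coordinate is one over the
    others. These can be exchanged with their copies in [c1], and over the copies and the last
    coordinate [a] is generic since [py] commutes with [q]. *)
Lemma comm_extend W' (q : set (formula L (W' + C))) : fin W' ->
  global_type q -> invt M q -> fsM q -> comm M0 px q -> comm M0 py q -> comm M0 p q.
Proof.
move=> fW' qG qI qf cx cy; have fO := fin_option fW.
apply: (comm_exists natK Kunc Chom Ms) => // E Eb.
have small_ := over_base_small natK Kunc Ms.
have [c1 gc1] := realize_type natK Kunc Csat fO pG (small_ _ Eb).
have E2b := over_baseU c1 fO Eb; set E2 := E `|` range c1 in E2b.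
have [a ga] := realize_type natK Kunc Csat fW' qG (small_ _ E2b).
have [c gc] := realize_type natK Kunc Csat fO pG (small_ _ (over_baseU a fW' E2b)).
have EE2 : E `<=` E2 by exact: subsetUl.
exists a, c; split; first exact: sub_gen ga.
  by apply: sub_gen gc; exact: setSU.
have cc1 : eqtp E c1 c by apply: gen_eqtp gc1 _; apply: sub_gen gc => x Ex; left; exact: EE2.
have gax := cx _ E2b _ _ ga (gen_pull Some gc).
have gay := cy _ E2b _ _ ga (gen_last gc); rewrite range_const in gay.
have E3b := over_baseU (c \o Some) fW E2b.
have E0b := over_baseU (const (c None)) fin_unit Eb; rewrite range_const in E0b.
have c1E2 : range (c1 \o Some) `<=` E2 by move=> _ [x _ <-]; right; exists (Some x).
have [cac|cac] := dich (c None) (over_base_sub E3b) (fs_gen_coh qf gax).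
  apply: (gen_eqtp_range natK Kunc Chom Ms Eb fW' fO qI (c := c1)) => //.
  apply: (coh_eqtp natK Kunc Chom Ms Eb fO cac) => //.
  - by move=> x Ex; left; left; exact: EE2.
  - by move=> x Ex; left; left; right.
  - by rewrite range_option; apply: setSU; exact: subsetUr.
rewrite range_option [_ `|` [set _]]setUC setUA.
apply: (gen_eqtp_range natK Kunc Chom Ms E0b fW' fW qI (c := c1 \o Some)).
  apply: sub_gen gay => x [[|]|/c1E2] h; [left; exact: EE2|right|left] => //.
rewrite -setUA [[set _] `|` _]setUC.
apply: (coh_eqtp natK Kunc Chom Ms Eb fW cac).
- by move=> x Ex; left; exact: EE2.
- by move=> x /c1E2; left.
- exact: subsetUr.
- move=> P e phi eE; have := cc1 P e (rename (sum_map Some id) phi) eE.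
  by rewrite !sat_rename !either_sum_map.
Qed.

(** In one case of the dichotomy the last coordinate joins the coheir directly; in the other the
    coheirs are composed in the opposite order, last coordinate first. *)
Lemma fs_extend : fsM px -> fsM py -> fsM p.
Proof.
move=> fx fy; apply: contrapT => /(not_fs_witness pG)[k [e0 e0P]].
have Eb := over_base_range M0 e0 (fin_vars k); set E := M `|` range e0 in Eb.
have small_ := over_base_small natK Kunc Ms.
have [a ga] := realize_type natK Kunc Csat (fin_option fW) pG (small_ _ Eb).
apply: (e0P E a _ ga); first exact: subsetUr.
have cx := fs_gen_coh fx (gen_pull Some ga).
have cy := fs_gen_coh fy (gen_last ga); rewrite range_const in cy.
rewrite range_option.
have [h|//] := dich (a None) (over_base_sub Eb) cx.
by rewrite setUC; apply: cohU cy h _; exact: over_base_sub.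
Qed.

End Extension.

(* Independent realizations of [p] and [q] over [E'] realize one type over [E];
   enlarging [E] to [E'] replaces the passage to realizations over all of [C]. *)
Definition orth V W (p : set (formula L (V + C))) (q : set (formula L (W + C))) : Prop :=
  forall E, over_base M0 E -> exists E', [/\ over_base M0 E', E `<=` E' &
    forall a c, gen q E' a -> gen p E' c -> gen q (E `|` range c) a].

(** The dichotomy applies even though neither of [a] and [c] is realized over the other. [E2] holds
    a copy of [c] and witnesses against its last coordinate, and induction handles the other
    coordinates over [E2]. *)
Lemma orth_not_fs k (p : set (formula L (vars k + C))) W (q : set (formula L (W + C))) :
  fin W -> global_type p -> invt M p ->
  global_type q -> invt M q -> fsM q ->
  (forall i, ~ fsM (pull (const i) p)) -> orth p q.
Proof.
move=> fW pG pI qG qI qf; elim: k p pG pI => [|k IH] p pG pI nf E Eb.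
  exists E; split=> // a c ga _; rewrite [range c](_ : _ = set0) ?setU0 //.
  by apply/seteqP; split=> // y [[]].
have small_ := over_base_small natK Kunc Ms.
have fO : fin (option (vars k)) := fin_vars k.+1.
have [c1 gc1] := realize_type natK Kunc Csat fO pG (small_ _ Eb).
have [l [e0 e0P]] := not_fs_witness (global_pull (const None) pG) (nf None).
have E2b := over_baseU e0 (fin_vars l) (over_baseU c1 fO Eb).
set E2 := E `|` range c1 `|` range e0 in E2b.
have [|||E' [E'b E2E' E'P]] := IH (pull Some p) _ _ _ E2 E2b.
- exact: global_pull.
- exact: invt_pull.
- by move=> i; rewrite pull_comp; exact: nf.
have EE2 : E `<=` E2 by move=> x Ex; left; left.
exists E'; split=> // [x /EE2/E2E'//|a c ga gc].
have gax := E'P _ _ ga (gen_pull Some gc).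
have E3b := over_baseU (c \o Some) (fin_vars k) E2b.
have [cac|cac] := dich (c None) (over_base_sub E3b) (fs_gen_coh qf gax).
  apply: (gen_eqtp_range natK Kunc Chom Ms Eb fW fO qI (c := c1)).
    by apply: sub_gen gax => x [Ex|cx]; left; left; [left|right].
  apply: (coh_eqtp natK Kunc Chom Ms Eb fO cac).
  - by move=> x Ex; left; left; exact: EE2.
  - by move=> x Ex; left; left; left; right.
  - by rewrite range_option; apply: setSU; exact: subsetUr.
  - by apply: gen_eqtp gc1 _; apply: sub_gen gc => x /EE2/E2E'.
have gc2 := gen_last (sub_gen E2E' gc).
case: (e0P E2 _ _ gc2); first exact: subsetUr.
by rewrite range_const; apply: sub_coh cac; [exact: subsetUr|exact: subsetUl].
Qed.

(** * Orthogonality to a generically stable type *)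

Section DefinableSide.
Context (W : Type) (fW : fin W) (r : set (formula L (W + C))).
Context (rG : global_type r) (rI : invt M r) (rf : fsM r) (rd : definable_type M r).

(* Let a realize p and c realize r.  If c does not realize r over a, then (c, a)
   realizes a type s finitely satisfied in M.  Since p is not definable, it fails
   to commute with some q finitely satisfied in M; for d realizing q and (c, a)
   realizing s over d, the dichotomy for d and a then shows that a realizes p
   over c, and p commutes with r. *)
Lemma orth_not_definable1 (p : set (formula L (unit + C))) :
  global_type p -> invt M p -> fsM p -> ~ definable_type M p -> orth p r.
Proof.
move=> pG pI pf nd E Eb; have small_ := over_base_small natK Kunc Ms.
have [k [q [qG qI qf]]] : exists k (q : set (formula L ('I_k + C))),
    [/\ global_type q, invt M q, fsM q & ~ comm M0 p q].
  apply: contrapT => H; apply: nd.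
  apply: (definable_of_comm natK Kunc Csat Chom ME Ms fin_unit pG pI) => k q qG qI qf.
  by apply: contrapT => ncomm; apply: H; exists k, q.
have fk : fin 'I_k by exact: fin_finType.
move=> /existsNP[E0 /not_implyP[E0b /existsNP[d0 /existsNP[a0 /not_implyP[gd0]]]]].
move=> /not_implyP[ga0 nd0].
(* Copies [a1], [c1], [d1] of all the elements to come are taken in advance, over a base including
   [E0], where [p] and [q] fail to commute. *)
have E1b := over_baseUU Eb E0b; set E1 := E `|` E0 in E1b.
have [a1 ga1] := realize_type natK Kunc Csat fin_unit pG (small_ _ E1b).
have [c1 gc1] := realize_type natK Kunc Csat fW rG (small_ _ E1b).
have E2b := over_baseU c1 fW (over_baseU a1 fin_unit E1b).
set E2 := E1 `|` range a1 `|` range c1 in E2b.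
have [d1 gd1] := realize_type natK Kunc Csat fk qG (small_ _ E2b).
have E'b := over_baseU d1 fk E2b; set E' := E2 `|` range d1 in E'b.
have EE1 : E `<=` E1 by exact: subsetUl.
have E12 : E1 `<=` E2 by move=> x; left; left.
have E2' : E2 `<=` E' by exact: subsetUl.
have a1E2 : range a1 `<=` E2 by move=> x; left; right.
have c1E2 : range c1 `<=` E2 by exact: subsetUr.
exists E'; split=> // [x /EE1/E12/E2'//|c a gc ga].
have aE (u : unit -> C) : range u = [set u tt].
  by rewrite {1}(_ : u = const (u tt)) ?range_const //; apply/funext=> -[].
have E1E' : E1 `<=` E' by move=> x /E12/E2'.
have [cca|cca] := dich (a tt) (over_base_sub E'b) (fs_gen_coh rf gc).
  apply: (gen_eqtp_range natK Kunc Chom Ms Eb fW fin_unit rI (c := a1)).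
    by apply: sub_gen gc => x [/EE1/E1E'|/a1E2/E2'].
  apply: (sub_eqtp (E' := E1 `|` range c)); first exact: setSU.
  apply: (coh_eqtp natK Kunc Chom Ms E1b fin_unit cca).
  - by move=> x /E1E'; left.
  - by move=> x /a1E2/E2'; left.
  - by rewrite aE; exact: subsetUr.
  - by apply: gen_eqtp ga1 _; exact: sub_gen ga.
have [s [sG sI sf gs]] : exists s, [/\ global_type s, invt M s, fsM s & gen s E' (either c a)].
  apply: coheir; apply: sub_coh cca => // x [[y|y] _ <-]; first by left; exists y.
  by right; case: y.
have fz := fin_sum fW fin_unit.
have [d gd] := realize_type natK Kunc Csat fk qG (small_ _ E'b).
have [z gz] := realize_type natK Kunc Csat fz sG (small_ _ (over_baseU d fk E'b)).
have gzE' : gen s E' z by apply: sub_gen gz; exact: subsetUl.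
have [t tE' tz] := eqtp_aut natK Kunc Chom fz (small_ _ E'b) (gen_eqtp gs gzE').
have [c' c'E] : exists c', c' = z \o inl by exists (z \o inl).
have [a' a'E] : exists a', a' = z \o inr by exists (z \o inr).
have tc : t \o c = c' by rewrite c'E -tz.
have ta : t \o a = a' by rewrite a'E -tz.
(* The claim is invariant under [t], so [c] and [a] may be replaced by their images, which together
   form a coheir over [d]. *)
suff : gen r (E `|` range a') c'.
  have [t' [t'E' tt' _]] := autE_inv tE'.
  have EE' : E `<=` E' by move=> x /EE1/E1E'.
  move=> /(gen_autE Eb rI (sub_autE EE' t'E')).
  have -> : t' \o a' = a by rewrite -ta; apply/funext=> x /=.
  by have -> : t' \o c' = c by rewrite -tc; apply/funext=> x /=.
have gc' : gen r E' c'.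
  by apply: eqtp_gen gc _; rewrite -tc; exact: autE_eqtp.
have ga' : gen p E' a'.
  by apply: eqtp_gen ga _; rewrite -ta; exact: autE_eqtp.
have d1d : eqtp E2 d1 d by apply: gen_eqtp gd1 _; exact: sub_gen gd.
have cohz := fs_gen_coh sf gz.
(* Being a coheir, [z] does not separate [d] from [d1]; thus [a'] and [c'] are generic over [d], as
   they are over [d1]. *)
have d1dz : eqtp (E2 `|` range z) d1 d.
  apply: (coh_eqtp natK Kunc Chom Ms E2b fk cohz _ _ _ d1d).
  - by move=> x; left; exact: E2'.
  - by move=> x hx; left; right.
  - exact: subsetUr.
have c'z : range c' `<=` range z by move=> _ [x _ <-]; exists (inl x); rewrite ?c'E.
have a'z : range a' `<=` range z by move=> _ [x _ <-]; exists (inr x); rewrite ?a'E.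
have ga'd : gen p (E2 `|` range d) a'.
  apply: (gen_eqtp_range natK Kunc Chom Ms E2b fin_unit fk pI (c := d1)) => //.
  by apply: sub_eqtp d1dz; exact: setUS.
have gc'd : gen r (E2 `|` range d) c'.
  apply: (gen_eqtp_range natK Kunc Chom Ms E2b fW fk rI (c := d1)) => //.
  by apply: sub_eqtp d1dz; exact: setUS.
have rq := definable_fs_comm rG qG rd qf.
have gdE2 : gen q E2 d by apply: sub_gen gd.
have gdc' := rq _ E2b _ _ gdE2 gc'd.
have E2c'b := over_baseU c' fW E2b.
have E0E1 : E0 `<=` E1 by exact: subsetUr.
have ga'1 : gen p E1 a' by exact: sub_gen ga'.
(* If [d] is a coheir over [a'], it is generic over [a'] through [a1], while [a'] is generic over
   [d]: this contradicts the failure of commuting at [E0]. Otherwise [a'] is a coheir over [c'], and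
   generic over it through [c1]. *)
have [cda|cda] := dich (a' tt) (over_base_sub E2c'b) (fs_gen_coh qf gdc').
  have gda' : gen q (E1 `|` range a') d.
    apply: (gen_eqtp_range natK Kunc Chom Ms E1b fk fin_unit qI (c := a1)).
      by apply: sub_gen gdE2 => x [/E12|/a1E2].
    apply: (coh_eqtp natK Kunc Chom Ms E1b fin_unit cda).
    - by move=> x /E12; left; left.
    - by move=> x /a1E2; left; left.
    - by rewrite aE; exact: subsetUr.
    - exact: gen_eqtp ga1 ga'1.
  case: nd0; apply: (comm_transfer natK Kunc Chom Ms fin_unit fk pI qI E0b (a := d) (c := a')) => //.
  - by apply: sub_gen gdE2 => x /E0E1/E12.
  - by apply: sub_gen ga'd; apply: setSU => x /E0E1/E12.
  - by apply: sub_gen gda'; exact: setSU.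
have gc'1 : gen r E1 c' by exact: sub_gen gc'.
have ga'c' : gen p (E1 `|` range c') a'.
  apply: (gen_eqtp_range natK Kunc Chom Ms E1b fin_unit fW pI (c := c1)).
    by apply: sub_gen ga' => x [/E1E'|/c1E2/E2'].
  apply: (coh_eqtp natK Kunc Chom Ms E1b fW (sub_coh _ (fun x h => h) cda)).
  - by rewrite aE; exact: subsetUr.
  - by move=> x /E12; left.
  - by move=> x /c1E2; left.
  - exact: subsetUr.
  - exact: gen_eqtp gc1 gc'1.
have rp := definable_fs_comm rG pG rd pf.
have := comm_sym natK Kunc Csat Chom Ms fW fin_unit rG pG rI pI rp E1b gc'1 ga'c'.
by apply: sub_gen; exact: setSU.
Qed.

Lemma orth_not_definable k (p : set (formula L (vars k + C))) :
  global_type p -> invt M p ->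
  (forall i, fsM (pull (const i) p) /\ ~ definable_type M (pull (const i) p)) -> orth p r.
Proof.
elim: k p => [|k IH] p pG pI pp E Eb.
  exists E; split=> // c a gc _; rewrite [range a](_ : _ = set0) ?setU0 //.
  by apply/seteqP; split=> // y [[]].
have small_ := over_base_small natK Kunc Ms.
have fO : fin (option (vars k)) := fin_vars k.+1.
have [a1 ga1] := realize_type natK Kunc Csat fO pG (small_ _ Eb).
have E3b := over_baseU a1 fO Eb; set E3 := E `|` range a1 in E3b.
have [pyf pyd] := pp None.
have [E4 [E4b E34 E4P]] := orth_not_definable1 (global_pull (const None) pG)
  (invt_pull _ pI) pyf pyd E3b.
have [|||E5 [E5b E45 E5P]] := IH (pull Some p) _ _ _ E4 E4b.
- exact: global_pull.
- exact: invt_pull.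
- by move=> i; rewrite pull_comp; exact: pp.
have EE3 : E `<=` E3 by exact: subsetUl.
exists E5; split=> // [x /EE3/E34/E45//|c a gc ga].
have gcx := E5P _ _ gc (gen_pull Some ga).
have E4ab := over_baseU (a \o Some) (fin_vars k) E4b.
have aa1 : eqtp E a1 a by apply: gen_eqtp ga1 _; apply: sub_gen ga => x /EE3/E34/E45.
have [cca|cca] := dich (a None) (over_base_sub E4ab) (fs_gen_coh rf gcx).
  apply: (gen_eqtp_range natK Kunc Chom Ms Eb fW fO rI (c := a1)).
    by apply: sub_gen gc => x /E34/E45.
  apply: (coh_eqtp natK Kunc Chom Ms Eb fO cca) => //.
  - by move=> x /EE3/E34; left; left.
  - by move=> x hx; left; left; apply: E34; right.
  - by rewrite range_option; apply: setSU; exact: subsetUr.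
have gcy := E4P _ _ (sub_gen E45 gc) (gen_last (sub_gen E45 ga)).
rewrite range_const in gcy.
have E0b := over_baseU (const (a None)) fin_unit Eb; rewrite range_const in E0b.
have a1E3 : range (a1 \o Some) `<=` E3 by move=> _ [x _ <-]; right; exists (Some x).
rewrite range_option [_ `|` [set _]]setUC setUA.
apply: (gen_eqtp_range natK Kunc Chom Ms E0b fW (fin_vars k) rI (c := a1 \o Some)).
  by apply: sub_gen gcy => x [[|]|/a1E3] h; [left; exact: EE3|right|left].
rewrite -setUA [[set _] `|` _]setUC.
apply: (coh_eqtp natK Kunc Chom Ms Eb (fin_vars k) cca).
- by move=> x /EE3/E34; left.
- by move=> x /a1E3/E34; left.
- exact: subsetUr.
- move=> P e phi eE; have := aa1 P e (rename (sum_map Some id) phi) eE.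
  by rewrite !sat_rename !either_sum_map.
Qed.

End DefinableSide.
End Decomposition.

(** * The decomposition *)

Lemma nat_card_sum X : ([set: nat] #<= [set: (nat + X)%type]).
Proof.
have [f] : $|{injfun [set: nat] >-> [set: (nat + X)%type]}|.
  by apply/injfunPex; exists inl => // x y _ _ [].
exact: inj_card_le f.
Qed.

Section Assembly.
Context (L : language) (K : Type) (C : structure L) (M0 : substructure C).
Context (natK : ([set: nat] #<= [set: K])) (Kunc : ~ ([set: K] #<= [set: nat])).
Context (Csat : saturated K C) (Chom : strongly_homogeneous K C).
Context (ME : elementary_substructure M0).
Local Notation M := (subset_of M0).
Context (Ms : small K M).
Context (dich : forall B E c, M `<=` E -> coh M B E ->
  coh M B (E `|` [set c]) \/ coh M (B `|` [set c]) E).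
Context (V : Type) (p : set (formula L (V + C))).
Context (fV : fin V) (pG : global_type p) (pI : invt M p).
Local Notation fsM := (finitely_satisfied_in M).
Local Notation const c := (fun _ : unit => c).
Local Notation one i := (pull (const i) p).

Lemma fs_or_definable i : fsM (one i) \/ definable_type M (one i).
Proof.
have [|nf] := pselect (fsM (one i)); [by left|right].
apply: (definable_of_comm natK Kunc Csat Chom ME Ms fin_unit); [exact: global_pull|exact: invt_pull|].
move=> k q qG qI qf; apply: (not_fs_comm natK Kunc Csat Chom Ms dich) => //.
- exact: fin_finType.
- exact: global_pull.
- exact: invt_pull.
Qed.

Lemma fs_tuple W (i : W -> V) : fin W -> (forall x, fsM (one (i x))) -> fsM (pull i p).
Proof.
move=> [k [s /choice[r sr]]] fi.
suff H : fsM (pull (i \o s) p).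
  rewrite (_ : pull i p = pull r (pull (i \o s) p)); first exact: fs_pull.
  by rewrite pull_comp (_ : (i \o s) \o r = i) //; apply/funext=> x /=; rewrite sr.
have : forall x, fsM (one ((i \o s) x)) by move=> x; exact: fi.
elim: k {r sr s} (i \o s) => [|k IH] {fi}j fj.
  move=> phi pphi; have [a [ha _ _]] := global_sat (global_pull j pG) pphi pphi pphi.
  by exists a => // -[].
apply: (fs_extend natK Kunc Csat Ms dich (fin_vars k)); first exact: global_pull.
  by rewrite pull_comp; apply: IH => x; exact: (fj (Some x)).
by rewrite pull_comp; exact: (fj None).
Qed.

(** By the criterion it is enough that the tuple commutes with coheirs, a property that extends by
    one coordinate at a time. *)
Lemma definable_tuple W (i : W -> V) : fin W ->
  (forall x, definable_type M (one (i x))) -> definable_type M (pull i p).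
Proof.
move=> [k [s /choice[r sr]]] di.
suff H : definable_type M (pull (i \o s) p).
  rewrite (_ : pull i p = pull r (pull (i \o s) p)); first exact: definable_pull.
  by rewrite pull_comp (_ : (i \o s) \o r = i) //; apply/funext=> x /=; rewrite sr.
have : forall x, definable_type M (one ((i \o s) x)) by move=> x; exact: di.
move: (i \o s) => {r sr s di}j dj.
apply: (definable_of_comm natK Kunc Csat Chom ME Ms (fin_vars k));
  [exact: global_pull|exact: invt_pull|move=> l q qG qI qf].
elim: k j dj => [|k IH] j dj.
  move=> E Eb a c ga _; rewrite [range c](_ : _ = set0) ?setU0 //.
  by apply/seteqP; split=> // y [[]].
have fl : fin 'I_l by exact: fin_finType.
apply: (comm_extend natK Kunc Csat Chom Ms dich (fin_vars k)) => //.
- exact: global_pull.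
- exact: invt_pull.
- by rewrite pull_comp; apply: IH => x; exact: (dj (Some x)).
- rewrite pull_comp; apply: definable_fs_comm => //; first exact: global_pull.
  exact: (dj None).
Qed.

Lemma realized_gen (N : structure L) (h : C -> N) (v : V -> N) E (a : V -> C)
    W (A : set V) (i : W -> A) :
  (forall P (e : P -> C) (phi : formula L (V + P)), (forall x, E (e x)) ->
     sat (either a e) phi <-> sat (either v (h \o e)) phi) ->
  (forall phi, pull val p phi -> sat (either v h) (rename (sum_map (val : A -> V) id) phi)) ->
  gen (pull (val \o i) p) E (a \o (val \o i)).
Proof.
move=> av vA P e phi eE.
have H psi : pull (val \o i) p (rename (sum_map id e) psi) -> sat (either (a \o (val \o i)) e) psi.
  move=> ppsi; have /vA : pull val p (rename (sum_map i e) psi).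
    by move: ppsi; rewrite /pull /= !rename_comp !sum_map_comp.
  rewrite sat_rename either_sum_map sat_rename either_sum_map => h1.
  have := av P e (rename (sum_map (val \o i) id) psi) eE.
  by rewrite !sat_rename !either_sum_map => h2; apply/h2.
split; first exact: H.
move=> h1; apply: contrapT => /(proj2 (global_neg (global_pull (val \o i) pG) _)).
by move=> /(H (Fneg phi)); apply.
Qed.

Section Orthogonality.
Context (F G D : set V).
Context (FGD : F `|` G `|` D = setT).
Context (Ff : forall i, F i -> fsM (one i) /\ ~ definable_type M (one i)).
Context (Gg : forall i, G i -> fsM (one i) /\ definable_type M (one i)).
Context (Dd : forall i, D i -> ~ fsM (one i)).
Context (N : structure L) (h : C -> N) (v : V -> N) (hE : elementary h).

(** The copy [a] of [v] in C is conjugate to a true realization [w] of [p] over the parameters of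
    the given formula: orthogonality makes tuples that agree on each part separately agree
    jointly. *)
Lemma orthogonal_entails :
  (forall phi, pull val p phi -> sat (either v h) (rename (sum_map (val : F -> V) id) phi)) ->
  (forall phi, pull val p phi -> sat (either v h) (rename (sum_map (val : G -> V) id) phi)) ->
  (forall phi, pull val p phi -> sat (either v h) (rename (sum_map (val : D -> V) id) phi)) ->
  realizes h v p.
Proof.
move=> vF vG vD phi pphi.
have [_ [_ [_ [l [j [q [_ jE]]]]]]] := finite_variables2 phi.
have small_ := over_base_small natK Kunc Ms.
have [kF [iF iFs]] := fin_sub F fV; have [kG [iG iGs]] := fin_sub G fV.
have [kD [iD iDs]] := fin_sub D fV.
pose jF := val \o iF; pose jG := val \o iG; pose jD := val \o iD.
pose jFG := either jF jG.
have elemP (A : set V) (x : A) : A (val x) by exact: (set_mem (valP x)).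
have fFG : fin (vars kF + vars kG) by apply: fin_sum; exact: fin_vars.
have pG' := fun W (i : W -> V) => global_pull i pG.
have pI' := fun W (i : W -> V) => invt_pull i pI.
have fsFG : fsM (pull jFG p).
  by apply: fs_tuple => // -[x|x]; [have [] := Ff (elemP _ (iF x))|have [] := Gg (elemP _ (iG x))].
have fsG : fsM (pull jG p).
  by apply: fs_tuple; [exact: fin_vars|move=> x; have [] := Gg (elemP _ (iG x))].
have dG : definable_type M (pull jG p).
  by apply: definable_tuple; [exact: fin_vars|move=> x; have [] := Gg (elemP _ (iG x))].
have orthFG : orth M0 (pull jF p) (pull jG p).
  apply: (orth_not_definable natK Kunc Csat Chom ME Ms dich) => //; first exact: fin_vars.
  by move=> x; rewrite pull_comp; exact: Ff (elemP _ (iF x)).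
have orthD : orth M0 (pull jD p) (pull jFG p).
  apply: (orth_not_fs natK Kunc Csat Chom Ms dich) => //.
  by move=> x; rewrite pull_comp; exact: Dd (elemP _ (iD x)).
(* The bases grow in the order opposite to their use: [E2] serves to join F and G over [E1], and
   [E1] to join D over [E0]. *)
have E0b := over_base_range M0 j (fin_vars l); set E0 := M `|` range j in E0b.
have [E1 [E1b E01 E1P]] := orthD E0 E0b.
have [E2 [E2b E12 E2P]] := orthFG E1 E1b.
have [a aP] := realize_tuple natK Kunc Csat v fV hE (small_ _ E2b).
have [w wP] := realize_type natK Kunc Csat fV pG (small_ _ E2b).
have gF := realized_gen iF aP vF; have gG := realized_gen iG aP vG.
have gD := realized_gen iD aP vD.
have [s [sE1 sF sG]] := pair_aut natK Kunc Chom Ms (fin_vars kG) (fin_vars kF)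
  (pI' _ jG) E1b
  (sub_gen E12 (gen_pull jF wP)) (E2P _ _ (gen_pull jG wP) (gen_pull jF wP))
  (sub_gen E12 gF) (E2P _ _ gG gF).
(* The conjugacy [s] says nothing of the D part; it shows that [a] realizes [p] jointly on F and G
   over [E1]. *)
have gFG : gen (pull jFG p) E1 (a \o jFG).
  have := gen_aut (pI' _ jFG) (sub_autE (over_base_sub E1b) sE1) (sub_gen E12 (gen_pull jFG wP)).
  rewrite aut_image_set // (_ : s \o (w \o jFG) = a \o jFG) //.
  by apply/funext=> -[x|x]; [exact: (congr1 (@^~ x) sF)|exact: (congr1 (@^~ x) sG)].
have [t [tE0 tD tFG]] := pair_aut natK Kunc Chom Ms fFG (fin_vars kD)
  (pI' _ jFG) E0b
  (sub_gen E01 (sub_gen E12 (gen_pull jD wP)))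
  (E1P _ _ (sub_gen E12 (gen_pull jFG wP)) (sub_gen E12 (gen_pull jD wP)))
  (sub_gen E01 (sub_gen E12 gD)) (E1P _ _ gFG (sub_gen E12 gD)).
have tw : t \o w = a.
  apply/funext=> x; have : (F `|` G `|` D) x by rewrite FGD.
  case=> [[]|] hx.
  - have [y yx] := iFs (elem hx); have := congr1 (@^~ (inl y)) tFG.
    by rewrite /= /jF /= yx.
  - have [y yx] := iGs (elem hx); have := congr1 (@^~ (inr y)) tFG.
    by rewrite /= /jG /= yx.
  - have [y yx] := iDs (elem hx); have := congr1 (@^~ y) tD.
    by rewrite /= /jD /= yx.
have jE0 x : E0 (j x) by right; exists x.
have : sat (either a j) (rename (sum_map id q) phi).
  rewrite -tw (sat_autE _ _ tE0) // -(wP _ j _ (fun x => E12 _ (E01 _ (jE0 x)))).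
  apply: (global_imp pG pphi) => u.
  by rewrite rename_comp sum_map_comp sat_rename either_sum_map jE.
rewrite aP; last by move=> x; exact/E12/E01/jE0.
by rewrite sat_rename either_sum_map [in X in _ -> X]jE.
Qed.

End Orthogonality.
End Assembly.

Lemma pull_restrict (L : language) (C : structure L) V (W : set V) (p : set (formula L (V + C))) :
  restrict_vars W p = pull (val : W -> V) p.
Proof. by []. Qed.

Theorem theorem3p12 (L : language) (T : theory L) (K : Type) (C : structure L)
    (M : substructure C) (n : nat) (p : set (formula L ('I_n + C))) :
  complete_theory T -> monadically_NIP T -> monster K T C ->
  elementary_substructure M -> small K M ->
  global_type p -> invariant_type M p ->
  let p_ (i : 'I_n) := restrict_vars [set i] p in
  let F := [set i | finitely_satisfied_in M (p_ i) /\ ~ definable_type M (p_ i)] in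
  let G := [set i | generically_stable M (p_ i)] in
  let D := [set i | definable_type M (p_ i) /\ ~ finitely_satisfied_in M (p_ i)] in
  let pF := restrict_vars F p in
  let pG := restrict_vars G p in
  let pD := restrict_vars D p in
  [/\ F `|` G `|` D = [set: 'I_n], F `&` G = set0, F `&` D = set0 &
      G `&` D = set0] /\
  [/\ finitely_satisfied_in M pF /\ (F !=set0 -> ~ definable_type M pF),
      generically_stable M pG,
      definable_type M pD /\ (D !=set0 -> ~ finitely_satisfied_in M pD) &
      triply_orthogonal pF pG pD /\
      entails (rename (sum_map val id) @` pF `|` rename (sum_map val id) @` pG
               `|` rename (sum_map val id) @` pD) p].
Proof.
move=> _ Tmon [TC [leK KnC] Csat Chom] ME Ms pGl pInv p_ F G D pF pG pD.
have natK : ([set: nat] #<= [set: K]) := card_le_trans (nat_card_sum _) leK.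
have Kunc : ~ ([set: K] #<= [set: nat]).
  by move=> Kn; apply: KnC; exact: card_le_trans Kn (nat_card_sum _).
have pI := invariant_invt pInv.
have dich := dichotomy natK Kunc Csat Chom ME Ms Tmon TC.
have fn : fin 'I_n by exact: fin_finType.
(* [p_ i] has its variable in the subtype of [i], [one i] in [unit]; each is a renaming of the
   other. *)
pose one i := pull (fun _ : unit => i) p.
have oneE i : one i = pull (fun _ : unit => elem (erefl : [set i] i)) (p_ i).
  by rewrite /p_ pull_restrict pull_comp.
have p_E i : p_ i = pull (fun _ => tt) (one i).
  rewrite /p_ /one pull_restrict pull_comp.
  by rewrite (_ : (fun _ => i) \o _ = val) //; apply/funext=> -[x /= hx]; rewrite (set_mem hx).
have fsE i : finitely_satisfied_in M (p_ i) <-> finitely_satisfied_in M (one i).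
  by split; [rewrite oneE|rewrite p_E]; exact: fs_pull.
have dE i : definable_type M (p_ i) <-> definable_type M (one i).
  by split; [rewrite oneE|rewrite p_E]; exact: definable_pull.
have fd i := fs_or_definable natK Kunc Csat Chom ME Ms dich pGl pI i.
have elemP (A : set 'I_n) (x : A) : A (val x) by exact: (set_mem (valP x)).
have FGD : F `|` G `|` D = [set: 'I_n].
  apply/seteqP; split=> // i _; have [hf|hd] := fd i.
    have [hd|hd] := pselect (definable_type M (one i)).
      by left; right; split; [exact/dE|exact/fsE].
    by left; left; split; [exact/fsE|move/dE].
  have [hf|hf] := pselect (finitely_satisfied_in M (one i)).
    by left; right; split; [exact/dE|exact/fsE].
  by right; split; [exact/dE|move/fsE].
have FG0 : F `&` G = set0 by apply/seteqP; split=> // i [[_ nd] [d _]].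
have FD0 : F `&` D = set0 by apply/seteqP; split=> // i [[_ nd] [d _]].
have GD0 : G `&` D = set0 by apply/seteqP; split=> // i [[_ f] [_ nf]].
have Ff i : F i -> finitely_satisfied_in M (one i) /\ ~ definable_type M (one i).
  by move=> [/fsE f nd]; split=> // /dE.
have Gg i : G i -> finitely_satisfied_in M (one i) /\ definable_type M (one i).
  by move=> [/dE d /fsE f].
have Dd i : D i -> ~ finitely_satisfied_in M (one i) by move=> [_ nf] /fsE.
have oneP (A : set 'I_n) i (Ai : A i) : one i = pull (fun _ => elem Ai) (restrict_vars A p).
  by rewrite pull_restrict pull_comp.
have fin_ A := fin_sub A fn.
have pent : entails (rename (sum_map val id) @` pF `|` rename (sum_map val id) @` pG
    `|` rename (sum_map val id) @` pD) p.
  move=> N h hE v vP.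
  apply: (orthogonal_entails natK Kunc Csat Chom ME Ms dich fn pGl pI FGD Ff Gg Dd hE).
  - by move=> phi pphi; apply: vP; left; left; exists phi.
  - by move=> phi pphi; apply: vP; left; right; exists phi.
  - by move=> phi pphi; apply: vP; right; exists phi.
split; first by [].
split.
- split; first by apply: (fs_tuple natK Kunc Csat Ms dich pGl (fin_ F)) => x; have [] := Ff _ (elemP _ x).
  move=> [i Fi] d; have [_] := Ff _ Fi; apply.
  by rewrite (oneP _ _ Fi); exact: definable_pull.
- split; first by apply: (definable_tuple natK Kunc Csat Chom ME Ms dich pGl pI (fin_ G)) => x; have [] := Gg _ (elemP _ x).
  by apply: (fs_tuple natK Kunc Csat Ms dich pGl (fin_ G)) => x; have [] := Gg _ (elemP _ x).
- split.
    apply: (definable_tuple natK Kunc Csat Chom ME Ms dich pGl pI (fin_ D)) => x.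
    by have [/dE] := elemP _ x.
  move=> [i Di] f; apply: (Dd _ Di).
  by rewrite (oneP _ _ Di); exact: fs_pull.
split=> //.
(* The bijection [pi] identifies the variables of the three parts with those of [p]; up to this
   renaming, the consequences of [Gamma] are [p] itself. *)
pose pi : F + G + D -> 'I_n := either (either val val) val.
have /choice[rho piK] : forall i, exists x, pi x = i.
  move=> i; have : (F `|` G `|` D) i by rewrite FGD.
  by case=> [[]|] hi; [exists (inl (inl (elem hi)))|exists (inl (inr (elem hi)))|exists (inr (elem hi))].
have piI : injective pi.
  have no (A B : set 'I_n) (x : 'I_n) : A `&` B = set0 -> A x -> B x -> False.
    by move=> AB0 Ax Bx; have : (A `&` B) x by []; rewrite AB0.
  have noE (A B : set 'I_n) (x : A) (y : B) : A `&` B = set0 -> val x = val y -> False.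
    by move=> AB0 xy; apply: (no A B (val x)) => //; [|rewrite xy]; exact: elemP.
  move=> [[x|x]|x] [[y|y]|y] xy; try by rewrite (val_inj xy).
  - by case: (noE _ _ x y FG0 xy).
  - by case: (noE _ _ x y FD0 xy).
  - by case: (noE _ _ y x FG0 (esym xy)).
  - by case: (noE _ _ x y GD0 xy).
  - by case: (noE _ _ y x FD0 (esym xy)).
  - by case: (noE _ _ y x GD0 (esym xy)).
have rhoK : cancel pi rho by move=> x; apply: piI; rewrite piK.
rewrite /triply_orthogonal; set Gamma := (X in entails X).
have GammaE : Gamma `<=` pull pi p.
  by move=> _ [[|]|] [phi pphi <-]; rewrite /pull /= rename_comp sum_map_comp; exact: pphi.
suff -> : [set phi | entails Gamma [set phi]] = pull pi p by exact: global_pull.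
apply/seteqP; split=> phi /= hphi.
  (* [Gamma] is contained in a type realized in an elementary extension, so it cannot entail a
     formula whose negation belongs to this type. *)
  apply: contrapT => /(proj2 (global_neg (global_pull pi pGl) _)) nphi.
  have [N [h [v [hE vP]]]] := compactness (global_pull pi pGl).1.
  have vG : realizes h v Gamma by move=> psi /GammaE /vP.
  by have := vP _ nphi; apply; apply: hphi vG _ _.
move=> N h hE v vP _ ->.
have rhov : v \o rho \o pi = v by apply/funext=> x /=; rewrite rhoK.
have := pent N h hE (v \o rho) _ (rename (sum_map pi id) phi) hphi.
rewrite sat_rename either_sum_map rhov; apply.
move=> psi [[|]|] [chi pchi <-]; rewrite sat_rename either_sum_map.
- have /vP : Gamma (rename (sum_map (inl \o inl) id) chi) by left; left; exists chi.
  rewrite sat_rename either_sum_map; congr (sat (either _ _) _).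
  by apply/funext=> x; exact: (congr1 v (esym (rhoK (inl (inl x))))).
- have /vP : Gamma (rename (sum_map (inl \o inr) id) chi) by left; right; exists chi.
  rewrite sat_rename either_sum_map; congr (sat (either _ _) _).
  by apply/funext=> x; exact: (congr1 v (esym (rhoK (inl (inr x))))).
- have /vP : Gamma (rename (sum_map inr id) chi) by right; exists chi.
  rewrite sat_rename either_sum_map; congr (sat (either _ _) _).
  by apply/funext=> x; exact: (congr1 v (esym (rhoK (inr x)))).
Qed.
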